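(* Let $\lambda=(\lambda_1,\dots,\lambda_r)\in\mathcal Y(r,n)$ and let $\tilde\lambda\in\mathcal Y(m,p,n)$ be the corresponding necklace. For each $\delta\in C_\lambda$ define $$V^{(\tilde\lambda,\delta)}:=\mathbb C\text{-span}\{v_T^{(\delta)}\mid T\in\mathrm{Tab}(r,\lambda)_{mb(\lambda)}\}.$$ Then: (a) The eigenspace decomposition of $V^\lambda$ with respect to the associator $\mathcal A^\lambda$ is $V^\lambda=\bigoplus_{\delta\in C_\lambda}V^{(\tilde\lambda,\delta)}$. (b) For each $\delta\in C_\lambda$, the eigenspace $V^{(\tilde\lambda,\delta)}$ is an irreducible $G(r,p,n)$-module. (c) The set $\{V^{(\tilde\lambda,\delta)}\mid\tilde\lambda\in\mathcal Y(m,p,n),\ \delta\in C_\lambda\}$ (one representative $\lambda$ being chosen for each class $\tilde\lambda$) is the complete set of irreducible $G(r,p,n)$-modules up to isomorphism.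
   Context: $r,p,n$ are positive integers, $p\mid r$, $m=r/p$; $\zeta$ is a primitive $r$-th root of unity and $G=\langle\zeta\rangle$. $G(r,1,n)=G^n\rtimes S_n$ is the group of $n\times n$ generalized permutation matrices with nonzero entries in $G$; $G(r,p,n)$ is the subgroup of those for which the $m$-th power of the product of nonzero entries is $1$. All modules are finite-dimensional over $\mathbb C$. $\mathcal Y(r,n)$: $r$-tuples of Young diagrams with $n$ boxes in total. $\mathrm{Tab}(r,\lambda)$: standard fillings $T=(T^1,\dots,T^r)$ of $\lambda$ with $1,\dots,n$, each used once, increasing along rows and columns of each component. $\sigma_i(\zeta)=\zeta^{i-1}$ ($1\le i\le r$) are the characters of $G$. Jucys–Murphy elements of $G(r,1,n)$: $X_1=0$, $X_j=\sum_{i<j}\sum_{l=0}^{r-1}\zeta_i^l\zeta_j^{-l}s_{ij}$, where $\zeta_i$ is the diagonal matrix with $\zeta$ in position $i$ and $1$ elsewhere and $s_{ij}$ is a transposition. The irreducible $G(r,1,n)$-module $V^\lambda$ has a Gelfand–Tsetlin basis $\{v_T\mid T\in\mathrm{Tab}(r,\lambda)\}$, unique up to scalars, such that if $i$ lies in box $b_T(i)$ of component $j_i$, then $G^n$ acts on $v_T$ by the character $\sigma_{j_1}\otimes\cdots\otimes\sigma_{j_n}$ and $X_iv_T=r\,c(b_T(i))v_T$, where the content $c$ of a box is its column index minus its row index; these properties determine $V^\lambda$. Necklaces: $\tilde\lambda_{(i,j)}=\lambda_{(j-1)m+i}$ for $1\le i\le m$, $1\le j\le p$; $\tilde\lambda,\tilde\mu$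 are equivalent if for some integer $t$, $\tilde\lambda_{(i,j)}=\tilde\mu_{(i,(j+t)\bmod p)}$ for all $i,j$; $\mathcal Y(m,p,n)$ is the set of necklaces with $n$ boxes up to equivalence. $\mathrm{sh}$ is the cyclic shift $(a_1,\dots,a_r)\mapsto(a_r,a_1,\dots,a_{r-1})$ on tuples of diagrams or tableaux. $\delta_0:G(r,1,n)\to\mathbb C^*$ sends a matrix to the product of its nonzero entries; $C=\langle\delta_0^m\rangle$ is cyclic of order $p$ and acts on irreducible $G(r,1,n)$-modules by $V\mapsto\delta\otimes V$, with $\delta_0^m\otimes V^\lambda\cong V^{\mathrm{sh}^m(\lambda)}$. $b(\lambda)$ is the number of distinct tuples $\mathrm{sh}^{im}(\lambda)$, $u(\lambda)=p/b(\lambda)$, and $C_\lambda=\langle\delta_0^{mb(\lambda)}\rangle$ is the stabilizer of $V^\lambda$, of order $u(\lambda)$. The element $\delta=\delta_0^{lmb(\lambda)}$, $0\le l\le u(\lambda)-1$, of $C_\lambda$ is identified with $\zeta^{lmb(\lambda)}$. The vectors $v_T$ are normalized so that $v_T\mapsto \mathbf 1\otimes v_{\mathrm{sh}^{-mb(\lambda)}(T)}$ is a $G(r,1,n)$-linear isomorphism $V^\lambda\to\delta_0^{mb(\lambda)}\otimes V^\lambda$. The associator is the $G(r,p,n)$-linear map $\mathcal A^\lambda:V^\lambda\to V^\lambda$, $v_T\mapsto v_{\mathrm{sh}^{-mb(\lambda)}(T)}$. For $1\le h\le r$: $\mathrm{Tab}(r,\lambda)_h=\{T\in\mathrm{Tab}(r,\lambda)\mid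 n\text{ lies in }T^{r-\nu}\text{ for some }0\le\nu<h\}$. For $\delta\in C_\lambda$ identified with $\zeta^{lmb(\lambda)}$ and $T\in\mathrm{Tab}(r,\lambda)_{mb(\lambda)}$: $v_T^{(\delta)}=\sum_{t=0}^{u(\lambda)-1}\zeta^{tlmb(\lambda)}v_{\mathrm{sh}^{tmb(\lambda)}(T)}$. *)

(* Defs.v *)
From HB Require Import structures.
From mathcomp Require Import all_boot all_order all_algebra all_fingroup.
From mathcomp Require Import mxrepresentation.

Set Implicit Arguments.
Unset Strict Implicit.
Unset Printing Implicit Defensive.

Import GRing.Theory Num.Theory.
Local Open Scope ring_scope.

(* The base field is any numClosedFieldType; the field of complex numbers
   (R[i] for R : realType) is an instance.

   All indices start at 0: the label k : 'I_n stands for k + 1, the component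
   c : 'I_r for c + 1, rows and columns likewise.

   Modules are MathComp representations rho acting on row vectors by
   v |-> v *m rho g, i.e., right modules.  The transposition g |-> g^T is an
   anti-automorphism of G(r,1,n) that fixes the diagonal matrices, the matrices
   s_ij, the Jucys-Murphy elements and delta_0, and preserves G(r,p,n); composing
   with it identifies left and right modules over both groups, and preserves
   submodules, Gelfand-Tsetlin bases and the associator. *)

Section Monomial.

Variables (F : numClosedFieldType) (r : nat) (z : F).

Definition cycG : seq F := [seq z ^+ k | k <- iota 0 r].

Definition gperm_mx n (A : 'M[F]_n) : bool :=
  [exists s : 'S_n, [forall i, forall j,
     if j == s i then A i j \in cycG else A i j == 0]].

Record Gr1n (prz : r.-primitive_root z) (n : nat) :=
  MkGr1n { gr1n_mx :> 'M[F]_n ; gr1n_mxP : gperm_mx gr1n_mx }.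

Hypothesis prz : r.-primitive_root z.

HB.instance Definition _ n := [isSub for @gr1n_mx prz n].

Lemma cycGE x : (x \in cycG) = (x ^+ r == 1).
Proof.
apply/mapP/eqP => [[k _ ->]|/(prim_rootP prz)[k ->]].
  by rewrite exprAC (prim_expr_order prz) expr1n.
by exists (k : nat) => //; rewrite mem_iota /= add0n.
Qed.

Lemma cycG_neq0 x : x \in cycG -> x != 0.
Proof.
rewrite cycGE; apply: contraTneq => ->.
by rewrite expr0n eqn0Ngt (prim_order_gt0 prz) /= eq_sym oner_eq0.
Qed.

Lemma gperm_mxP n (A : 'M[F]_n) :
  reflect (exists s : 'S_n, (forall i, A i (s i) \in cycG) /\
             (forall i j, j != s i -> A i j = 0))
          (gperm_mx A).
Proof.
apply: (iffP existsP) => -[s].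
  move=> /'forall_forallP sP; exists s; split=> [i|i j ji].
    by have := sP i (s i); rewrite eqxx.
  by have := sP i j; rewrite (negPf ji) => /eqP.
move=> [s1 s2]; exists s; apply/'forall_forallP => i j.
by case: eqVneq => [->|/s2->].
Qed.

Section Entry.
Variables (n : nat) (A : 'M[F]_n) (s : 'S_n).
Hypothesis s0 : forall i j, j != s i -> A i j = 0.

Lemma gperm_mulmxE p (B : 'M_(n, p)) i j : (A *m B) i j = A i (s i) * B (s i) j.
Proof.
rewrite mxE (bigD1 (s i)) //= big1 ?addr0 // => k ki.
by rewrite s0 ?mul0r.
Qed.

End Entry.

Lemma gperm_mul n (A B : 'M[F]_n) :
  gperm_mx A -> gperm_mx B -> gperm_mx (A *m B).
Proof.
move=> /gperm_mxP[s [s1 s2]] /gperm_mxP[t [t1 t2]]; apply/gperm_mxP.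
exists (s * t)%g; split=> [i|i j]; rewrite permM (gperm_mulmxE s2).
  rewrite cycGE exprMn.
  by have /eqP-> : A i (s i) ^+ r == 1; rewrite -?cycGE // mul1r -cycGE.
by move=> ji; rewrite t2 ?mulr0.
Qed.

Lemma gperm_diag n (d : 'rV[F]_n) :
  (forall i, d 0 i \in cycG) -> gperm_mx (diag_mx d).
Proof.
move=> dG; apply/gperm_mxP; exists 1%g.
split=> [i|i j]; rewrite perm1 mxE ?eqxx ?mulr1n // => ji.
by rewrite eq_sym (negPf ji).
Qed.

Lemma gperm_1 n : gperm_mx (1%:M : 'M[F]_n).
Proof.
rewrite -diag_const_mx; apply: gperm_diag => i.
by rewrite mxE cycGE expr1n.
Qed.

Lemma gperm_tperm n (i j : 'I_n) : gperm_mx (tperm_mx i j : 'M[F]_n).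
Proof.
apply/gperm_mxP; exists (tperm i j).
split=> [k|k l]; rewrite !mxE ?eqxx ?cycGE ?expr1n // => kl.
by rewrite eq_sym (negPf kl).
Qed.

Definition ginv n (A : 'M[F]_n) : 'M[F]_n := \matrix_(i, j) (A j i)^-1.

Lemma gperm_inv n (A : 'M[F]_n) : gperm_mx A -> gperm_mx (ginv A).
Proof.
move=> /gperm_mxP[s [s1 s2]]; apply/gperm_mxP; exists s^-1%g.
split=> [i|i j ji]; rewrite mxE.
  have := s1 (s^-1%g i); rewrite permKV !cycGE exprVn => /eqP->.
  by rewrite invr1.
rewrite s2 ?invr0 //; apply: contra ji => /eqP->.
by rewrite permK.
Qed.

Lemma ginvP n (A : 'M[F]_n) : gperm_mx A -> ginv A *m A = 1%:M.
Proof.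
move=> gA; have /gperm_mxP[t [t1 t2]] := gperm_inv gA.
move: gA => /gperm_mxP[s [s1 s2]].
have ts i : s (t i) = i.
  apply: contraTeq (t1 i) => e; rewrite mxE s2 1?eq_sym // invr0.
  by apply/negP => /cycG_neq0; rewrite eqxx.
apply/matrixP => i j; rewrite (gperm_mulmxE t2) !mxE.
have [<-|ij] := eqVneq i j.
  by rewrite mulVf // -{2}[i]ts; apply/cycG_neq0/s1.
by rewrite (s2 (t i) j) ?mulr0 // ts eq_sym.
Qed.

Section Instances.

Variable n : nat.
Local Notation gT := (Gr1n prz n).

Definition gr1n_code (g : gT) : {ffun 'I_n * 'I_n -> option 'I_r} :=
  [ffun ij => [pick k : 'I_r | g ij.1 ij.2 == z ^+ k]].

Definition gr1n_decode (f : {ffun 'I_n * 'I_n -> option 'I_r}) : option gT :=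
  insub (\matrix_(i, j) oapp (fun k : 'I_r => z ^+ k) 0 (f (i, j))).

Lemma gr1n_codeK : pcancel gr1n_code gr1n_decode.
Proof.
move=> g; rewrite /gr1n_decode.
suff -> : \matrix_(i, j) oapp (fun k : 'I_r => z ^+ k) 0 (gr1n_code g (i, j))
          = val g by rewrite valK.
apply/matrixP => i j; rewrite !mxE ffunE /=.
case: pickP => [k /eqP//|nk] /=.
have /gperm_mxP[s [s1 s2]] := gr1n_mxP g.
case: (eqVneq j (s i)) => [ji|/s2//].
have /mapP[k] := s1 i; rewrite mem_iota /= add0n => kr e.
by have := nk (Ordinal kr); rewrite ji e eqxx.
Qed.

HB.instance Definition _ := Finite.copy gT (pcan_type gr1n_codeK).

Definition gr1n_mul (g h : gT) : gT :=
  MkGr1n prz (gperm_mul (gr1n_mxP g) (gr1n_mxP h)).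
Definition gr1n_one : gT := MkGr1n prz (gperm_1 n).
Definition gr1n_inv (g : gT) : gT := MkGr1n prz (gperm_inv (gr1n_mxP g)).

Lemma gr1n_mulA : associative gr1n_mul.
Proof. by move=> a b c; apply: val_inj; apply: mulmxA. Qed.
Lemma gr1n_mul1 : left_id gr1n_one gr1n_mul.
Proof. by move=> a; apply: val_inj; apply: mul1mx. Qed.
Lemma gr1n_mulV : left_inverse gr1n_one gr1n_inv gr1n_mul.
Proof. by move=> a; apply: val_inj; apply: (ginvP (gr1n_mxP a)). Qed.

HB.instance Definition _ := Finite_isGroup.Build gT
  gr1n_mulA gr1n_mul1 gr1n_mulV.

Definition delta0 (g : gT) : F := \prod_i \prod_(j | g i j != 0) g i j.

Lemma delta0M (g h : gT) : delta0 (g * h)%g = delta0 g * delta0 h.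
Proof.
have d0E (x : gT) (s : 'S_n) : (forall i, x i (s i) \in cycG) ->
    (forall i j, j != s i -> x i j = 0) -> delta0 x = \prod_i x i (s i).
  move=> s1 s2; apply: eq_bigr => i _.
  rewrite (big_pred1 (s i)) // => j; rewrite /=.
  have [->|/s2->] := eqVneq j (s i); first by rewrite cycG_neq0.
  by rewrite eqxx.
have /gperm_mxP[s [s1 s2]] := gr1n_mxP g.
have /gperm_mxP[t [t1 t2]] := gr1n_mxP h.
have E i j : (g * h)%g i j = g i (s i) * h (s i) j by exact: gperm_mulmxE.
rewrite (d0E g s) // (d0E h t) // (d0E _ (s * t)%g).
- rewrite [X in _ = _ * X](reindex_inj (@perm_inj _ s)) -big_split /=.
  by apply: eq_bigr => i _; rewrite E permM.
- move=> i; rewrite E permM; move: (s1 i) (t1 (s i)).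
  by rewrite !cycGE exprMn => /eqP-> /eqP->; rewrite mulr1.
- by move=> i j; rewrite permM E => ji; rewrite t2 ?mulr0.
Qed.

Lemma cycG_zeta (i j : 'I_n) :
  (\row_(k < n) (if k == i then z else 1)) 0 j \in cycG.
Proof.
by rewrite mxE cycGE; case: ifP; rewrite ?(prim_expr_order prz) ?expr1n.
Qed.

Definition zetag (i : 'I_n) : gT := MkGr1n prz (gperm_diag (cycG_zeta i)).

Definition sg (i j : 'I_n) : gT := MkGr1n prz (gperm_tperm i j).

Definition Grpn_set (p : nat) : {set gT} :=
  [set g : gT | delta0 g ^+ (r %/ p) == 1].

Lemma Grpn_group_set p : group_set (Grpn_set p).
Proof.
have d1 : delta0 1%g = 1.
  rewrite /delta0 big1 // => i _.
  rewrite (big_pred1 i) => [|j /=]; rewrite mxE ?eqxx // [i == j]eq_sym.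
  case: (j == i); last by rewrite eqxx. 
  by rewrite oner_eq0.
apply/group_setP; split=> [|g h]; first by rewrite inE d1 expr1n.
by rewrite !inE delta0M exprMn => /eqP-> /eqP->; rewrite mulr1.
Qed.

Canonical Grpn (p : nat) : {group gT} := Group (Grpn_group_set p).

End Instances.

End Monomial.

Section Combinatorics.

Variables (r n : nat).

(* A box is (row, column).  A diagram with at most n boxes lies in the
   n x n square. *)
Definition box := ('I_n * 'I_n)%type.

Definition young (D : {set box}) : bool :=
  [forall b in D, forall b' : box,
     (b'.1 <= b.1)%N && (b'.2 <= b.2)%N ==> (b' \in D)].

Definition multidiag := {ffun 'I_r -> {set box}}.

Definition calY : {set multidiag} :=
  [set la : multidiag |
     [forall c, young (la c)] && (\sum_c #|la c| == n)%N].

(* A filling t sends a box to None when the box is outside the diagram. *)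
Definition filling := {ffun box -> option 'I_n}.

Definition increasing (t : filling) : bool :=
  [forall b : box, forall b' : box, forall k : 'I_n, forall k' : 'I_n,
     [&& t b == Some k, t b' == Some k' &
         ((b.1 == b'.1) && (b.2 < b'.2)%N) || ((b.2 == b'.2) && (b.1 < b'.1)%N)]
     ==> (k < k')%N].

Definition tableau := {ffun 'I_r -> filling}.

Definition Tab (la : multidiag) : {set tableau} :=
  [set T : tableau |
     [&& [forall c, forall b, (T c b != None) == (b \in la c)],
         [forall k : 'I_n,
            #|[set cb : 'I_r * box | T cb.1 cb.2 == Some k]| == 1%N]
       & [forall c, increasing (T c)]]].

Definition lies_in (k : 'I_n) (t : filling) : bool := Some k \in codom t.

(* The component T^{r - nu} has 0-based index r - nu - 1 = rev_ord nu. *)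
Definition Tab_last (la : multidiag) (h : nat) : {set tableau} :=
  [set T in Tab la |
     [exists k : 'I_n, exists nu : 'I_r,
        [&& k.+1 == n, (nu < h)%N & lies_in k (T (rev_ord nu))]]].

Definition sh (A : Type) (a : {ffun 'I_r -> A}) : {ffun 'I_r -> A} :=
  [ffun c => a (ord_pred c)].

Definition shV (A : Type) (a : {ffun 'I_r -> A}) : {ffun 'I_r -> A} :=
  [ffun c => a (ordS c)].

Lemma shK (A : Type) : cancel (@sh A) (@shV A).
Proof. by move=> a; apply/ffunP => c; rewrite !ffunE ordSK. Qed.

Lemma shVK (A : Type) : cancel (@shV A) (@sh A).
Proof. by move=> a; apply/ffunP => c; rewrite !ffunE ord_predK. Qed.

Variable p : nat.
Local Notation m := (r %/ p)%N.

(* The iterates of sh^m form a cycle, so fingraph.order counts the distinct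
   tuples sh^{im}(la). *)
Definition bnum (la : multidiag) : nat := fingraph.order (iter m (@sh {set box})) la.

Definition unum (la : multidiag) : nat := p %/ bnum la.

(* 0-based, la_{(j-1)m+i} becomes la (j * m + i). *)
Definition necklace (la : multidiag) : {ffun 'I_m * 'I_p -> {set box}} :=
  [ffun ij : 'I_m * 'I_p => oapp la set0 (insub (ij.2 * m + ij.1)%N)].

(* The shift t matters only modulo p. *)
Definition necklace_eq (la mu : multidiag) : bool :=
  [exists t : 'I_p, forall i : 'I_m, forall j : 'I_p, forall j' : 'I_p,
     (nat_of_ord j' == (j + t) %% p)%N
     ==> (necklace la (i, j) == necklace mu (i, j'))].

Definition calYmp : {set {set multidiag}} :=
  equivalence_partition necklace_eq calY.

End Combinatorics.

Lemma necklaceE r n p (la : multidiag r n) (i : 'I_(r %/ p)%N) (j : 'I_p)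
    (c : 'I_r) :
  nat_of_ord c = (j * (r %/ p) + i)%N -> necklace p la (i, j) = la c.
Proof. by move=> e; rewrite ffunE /= -e valK. Qed.

Section Modules.

Variables (F : numClosedFieldType) (r : nat) (z : F).
Hypothesis prz : r.-primitive_root z.
Variable n : nat.
Local Notation gT := (Gr1n prz n).
Local Notation tab := (tableau r n).
Local Notation mdiag := (multidiag r n).

Section Representation.

Variables (d : nat) (rho : mx_representation F [set: gT] d).

Definition JM (j : 'I_n) : 'M[F]_d :=
  \sum_(i < n | (i < j)%N) \sum_(l < r)
    rho (zetag prz i ^+ l * zetag prz j ^- l * sg prz i j)%g.

Variables (la : mdiag) (v : tab -> 'rV[F]_d).

Definition tab_mx : 'M[F]_(#|Tab la|, d) := \matrix_k v (enum_val k).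

(* Only the values of v on Tab la matter.  The character sigma_{c+1} of G is
   x |-> x ^+ c, and j - i is the content of the box (i, j). *)
Record GT_basis : Prop := GTBasis {
  GT_irr : mx_irreducible rho;
  GT_free : row_free tab_mx;
  GT_full : row_full tab_mx;
  GT_diag : forall T (g : gT), T \in Tab la -> is_diag_mx g ->
    v T *m rho g
    = (\prod_(k < n) \prod_(c < r | lies_in k (T c)) g k k ^+ c) *: v T;
  GT_JM : forall T (k : 'I_n) (c : 'I_r) (i j : 'I_n),
    T \in Tab la -> T c (i, j) = Some k ->
    v T *m JM k = (r%:R * (j%:R - i%:R)) *: v T
}.

Variable p : nat.
Local Notation m := (r %/ p)%N.
Local Notation mb := (m * bnum p la)%N.

Definition shV_mb (T : tab) : tab := iter mb (@shV r (filling n)) T.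

(* When v is a basis, this is the linear map v_T |-> v_{sh^{-mb}(T)}:
   see associatorE. *)
Definition associator : 'M[F]_d :=
  pinvmx tab_mx *m \matrix_(k < #|Tab la|) v (shV_mb (enum_val k)).

Lemma associatorE T : row_free tab_mx -> T \in Tab la ->
  v T *m associator = v (shV_mb T).
Proof.
move=> fr TT; pose k := enum_rank_in TT T.
have vT : v T = row k tab_mx by rewrite rowK enum_rankK_in.
rewrite vT rowE -mulmxA [tab_mx *m _]mulmxA mulmxVp // mul1mx -rowE rowK.
by rewrite enum_rankK_in.
Qed.

(* The underlying space of delta_0^{mb} \otimes V is that of V, with g acting by
   delta_0(g)^{mb} *: rho g. *)
Definition normalized : Prop :=
  forall g : gT,
    rho g *m associator = associator *m (delta0 g ^+ mb *: rho g).

(* delta = delta_0^{l mb} *)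
Definition vdelta (l : nat) (T : tab) : 'rV[F]_d :=
  \sum_(t < unum p la) z ^+ (t * (l * mb)) *:
    v (iter (t * mb) (@sh r (filling n)) T).

Definition Vdelta (l : nat) : 'M[F]_d :=
  <<\matrix_(k < #|Tab_last la mb|) vdelta l (enum_val k)>>%MS.

Definition res_Grpn : mx_representation F (Grpn prz n p) d :=
  subg_repr rho (subsetT (Grpn prz n p)).

End Representation.

End Modules.

(* The submodule U of rho is isomorphic to the module of rho'. *)
Definition affords (F : fieldType) (gT : finGroupType) (G : {group gT})
    d d' (rho : mx_representation F G d) (U : 'M[F]_d)
    (rho' : mx_representation F G d') : Prop :=
  exists Umod : mxmodule rho U, mx_rsim (submod_repr Umod) rho'.

(* Main.v *)
(* Let G = G(r,1,n) and H = G(r,p,n).  A nonzero G-map V^la -> delta_0^e (x) V^mu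
   matches the weights (components and contents of the labels) of the two
   Gelfand-Tsetlin bases up to a shift of the components by e; a weight determines
   its tableau, so such a map exists only if la = sh^e mu.  The H-maps
   V^la -> V^mu split, under conjugation by the cyclic group G/H, into such
   twisted G-maps.  Hence End_H(V^la) is spanned by the powers of the associator,
   which by Maschke makes its eigenspaces simple and pairwise non-isomorphic, and
   restrictions from distinct necklaces share no constituent.

   Completeness for H reduces to completeness for G by mapping the regular
   representation of G onto a given H-module.  For G it follows from
   sum_la (dim V^la)^2 = r^n n!, i.e., from the up-down relation of the lattice
   of r-tuples of Young diagrams: a tuple has r more addable than removable
   boxes. *)
Require Import Defs.
From HB Require Import structures.
From mathcomp Require Import all_boot all_order all_algebra all_fingroup.
From mathcomp Require Import mxrepresentation.
From mathcomp Require Import pgroup zify.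

Set Implicit Arguments.
Unset Strict Implicit.
Unset Printing Implicit Defensive.

(** * Linear extensions *)

(** The modules [V^la] enter as data with a weight basis; that they exhaust the irreducibles is not
    part of the data, nor is [delta_0^e (x) V^la = V^(sh^e la)] for a general [e]. Completeness is
    therefore obtained by counting, and the general twist isomorphism is read off afterwards: a
    twist of [V^la] is irreducible, hence some [V^mu], and its weights force [mu = sh^e la]. The
    count needs two inequalities only, [|G| <= r^n n!] and [r^n n! <= sum_la |Tab la|^2], because
    pairwise non-isomorphic irreducibles cannot exceed the order of the group. Hence it is enough
    that linear extensions inject into standard tableaux. Diagrams are confined to an [n x n]
    square, so the up-down relation is used only below [n] boxes, where the square cuts off no
    addable box. Twisted parts exist only for maps between the full spaces [V^la], whereas
    simplicity and isomorphism concern submodules. Maschke projections bridge the two: a submodule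
    becomes an idempotent, and an isomorphism of submodules extends to the full spaces. *)

Section LinearExtensions.

Variables (B : finType) (ideal : pred {set B}).
Hypotheses (idealI : forall D E, ideal D -> ideal E -> ideal (D :&: E))
           (idealU : forall D E, ideal D -> ideal E -> ideal (D :|: E)).

Definition addable (D : {set B}) := [set x | (x \notin D) && ideal (x |: D)].
Definition removable (D : {set B}) := [set x in D | ideal (D :\ x)].

(** The argument [k] is recursion fuel, meant to be [#|D|]. A sequence lists [D] in order of
    insertion, so its last entry is the element removed first. *)
Fixpoint linext k (D : {set B}) : seq (seq B) :=
  if k is k'.+1 then
    [seq rcons s x | x <- enum (removable D), s <- linext k' (D :\ x)]
  else [:: [::]].

Lemma linext_uniq k (D : {set B}) : uniq (linext k D).
Proof.
elim: k D => //= k IHk D; apply: allpairs_uniq_dep => [|x _|]; rewrite ?enum_uniq //.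
move=> [x s] [y t] _ _ /= /eqP; rewrite eqseq_rcons => /andP[/eqP-> /eqP->] //.
Qed.

(** For a Young diagram this is the number of standard tableaux of that shape. *)
Definition nlinext (D : {set B}) := size (linext #|D| D).

Lemma nlinextE (D : {set B}) : (0 < #|D|)%N ->
  nlinext D = (\sum_(x in removable D) nlinext (D :\ x))%N.
Proof.
rewrite /nlinext; case E : #|D| => [//|k] _ /=.
rewrite size_allpairs_dep sumnE big_map big_enum /=.
apply: eq_bigr => x; rewrite inE => /andP[xD _].
by congr (size (linext _ _)); move: E; rewrite (cardsD1 x) xD => -[].
Qed.

Lemma size_linext k (D : {set B}) s : #|D| = k -> s \in linext k D -> size s = k.
Proof.
elim: k D s => [|k IHk] D s Dk; first by rewrite inE => /eqP->.
move=> /allpairsPdep[x [t]] []; rewrite mem_enum inE => /andP[xD _] tL ->.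
rewrite size_rcons (IHk _ _ _ tL) //.
by move: Dk; rewrite (cardsD1 x) xD => -[].
Qed.

Lemma mem_linext k (D : {set B}) s : #|D| = k -> s \in linext k D -> s =i D.
Proof.
elim: k D s => [|k IHk] D s Dk.
  by rewrite inE => /eqP-> x; rewrite (cards0_eq Dk) inE.
move=> /allpairsPdep[x [t]] []; rewrite mem_enum inE => /andP[xD _] tL -> y.
have Dx : #|D :\ x| = k by move: Dk; rewrite (cardsD1 x) xD => -[].
by rewrite mem_rcons inE (IHk _ _ Dx tL) !inE; case: eqVneq => [->|].
Qed.

Lemma linext_prefix_ideal k (D : {set B}) s : #|D| = k -> ideal D -> s \in linext k D ->
  forall j, (j <= k)%N -> ideal [set x in take j s].
Proof.
elim: k D s => [|k IHk] D s Dk iD sL j jk.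
  move: sL jk; rewrite inE leqn0 => /eqP-> /eqP->.
  by rewrite (_ : finset _ = D) // (cards0_eq Dk); apply/setP=> x; rewrite !inE.
have := mem_linext Dk sL; have := size_linext Dk sL.
case/allpairsPdep: sL => x [t] []; rewrite mem_enum inE => /andP[xD iDx] tL ->.
rewrite size_rcons => -[st] sD.
have [jk'|jk'] := leqP j k.
  rewrite -cats1 takel_cat ?st //; apply: IHk tL _ jk' => //.
  by move: Dk; rewrite (cardsD1 x) xD => -[].
rewrite take_oversize ?size_rcons ?st // (_ : finset _ = D) //.
by apply/setP => y; rewrite inE sD.
Qed.

Variables (r n : nat).
Hypothesis addable_removable : forall D : {set B}, ideal D -> (#|D| < n)%N ->
  #|addable D| = (#|removable D| + r)%N.

(** Adding [x] and removing another element [y] commute in a lattice of sets: [D :\ y] is the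
    intersection of [D] with [(x |: D) :\ y], and [x |: D] is the union of [D] with
    [x |: (D :\ y)]. *)
Lemma sum_add_remove_swap (D : {set B}) (h : B -> B -> nat) : ideal D ->
  (\sum_(x in addable D) \sum_(y in removable (x |: D) | y != x) h x y =
   \sum_(y in removable D) \sum_(x in addable (D :\ y) | x != y) h x y)%N.
Proof.
move=> iD; rewrite !pair_big_dep /=.
rewrite (reindex_onto (fun p => (p.2, p.1)) (fun p => (p.2, p.1))).
  apply: eq_bigl => -[x y]; rewrite !inE /= eqxx andbT.
  have [->|xy] := eqVneq x y; first by rewrite !andbF.
  rewrite /= !andbT.
  have [xD|xD] := boolP (x \in D); last by rewrite !andbF.
  have [yD|yD] := boolP (y \in D); rewrite /= ?andbF //.
  have E : (y |: D) :\ x = y |: (D :\ x).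
    by apply/setP => w; rewrite !inE; case: (eqVneq w y) => [->|] //=; rewrite eq_sym xy.
  rewrite E; apply/andP/andP => -[i1 i2]; split => //.
    rewrite (_ : D :\ x = D :&: (y |: (D :\ x))); first exact: idealI.
    apply/setP => w; rewrite !inE; case: (eqVneq w y) => [->|_].
      by rewrite (negPf yD) andbF.
    by case: (w \in D); rewrite ?andbF ?andbT.
  rewrite (_ : y |: D = D :|: (y |: (D :\ x))); first exact: idealU.
  apply/setP => w; rewrite !inE; case: (eqVneq w y) => [->|_]; first by rewrite orbT.
  by case: (w \in D); rewrite ?andbF ?andbT.
by case.
Qed.

(** Induction on [#|D|]. Expand each [nlinext (x |: D)] by its last element. The terms removing [x]
    again give [#|removable D| + r] copies of [nlinext D]; the others, after the swap, complete the
    sums over [addable (D :\ y)] and give [r * #|D|] copies by induction. *)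
Lemma sum_nlinext_addable (D : {set B}) : ideal D -> (#|D| < n)%N ->
  (\sum_(x in addable D) nlinext (x |: D) = r * #|D|.+1 * nlinext D)%N.
Proof.
elim: {D}_.+1 {-2}D (ltnSn #|D|) => // k IHk D Dk iD Dn.
have addE x : x \in addable D ->
    nlinext (x |: D) = (nlinext D +
      \sum_(y in removable (x |: D) | y != x) nlinext ((x |: D) :\ y))%N.
  rewrite inE => /andP[xD ixD].
  rewrite nlinextE ?cardsU1 ?xD // (bigD1 x) /= ?setU1K //.
  by rewrite !inE eqxx setU1K.
rewrite (eq_bigr _ addE) big_split /= sum_nat_const sum_add_remove_swap //.
rewrite addable_removable //.
have remE y : y \in removable D ->
  (nlinext D + \sum_(x in addable (D :\ y) | x != y) nlinext ((x |: D) :\ y) = 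
   r * #|D| * nlinext (D :\ y))%N.
  rewrite inE => /andP[yD iDy].
  have Dy : (#|D| = #|D :\ y|.+1)%N by rewrite (cardsD1 y) yD.
  rewrite Dy -IHk //; last 2 first.
  - by rewrite -Dy.
  - by apply: leq_trans Dn; rewrite Dy.
  rewrite [RHS](bigD1 y) /=; last by rewrite !inE eqxx setD1K.
  rewrite setD1K //; congr addn; apply: eq_bigr => x /andP[_ xy].
  congr nlinext; apply/setP => w; rewrite !inE.
  by case: (eqVneq w y) => [->|//]; rewrite /= orbF eq_sym (negPf xy).
have -> : ((#|removable D| + r) * nlinext D =
           r * nlinext D + \sum_(y in removable D) nlinext D)%N.
  by rewrite sum_nat_const mulnDl addnC.
rewrite -addnA -big_split /= (eq_bigr _ remE).
have [D0|D0] := posnP #|D|.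
  rewrite D0 muln1 big1 ?addn0 // => y; rewrite inE.
  by rewrite (cards0_eq D0) inE.
by rewrite -big_distrr /= -nlinextE // mulnS mulnDl.
Qed.

Lemma sum_nlinext_sqr k : ideal set0 -> (k <= n)%N ->
  (\sum_(D : {set B} | ideal D && (#|D| == k)) nlinext D ^ 2 = r ^ k * k`!)%N.
Proof.
move=> i0; elim: k => [|k IHk] kn.
  rewrite (big_pred1 set0) => [|D /=]; first by rewrite /nlinext cards0.
  by rewrite cards_eq0; case: eqVneq => [->|]; rewrite ?i0 ?andbF.
transitivity (\sum_(D : {set B} | ideal D && (#|D| == k))
   \sum_(x in addable D) nlinext D * nlinext (x |: D))%N.
  (* One of the two factors is expanded by its last element. A [k.+1]-element ideal with a removable
     element is the same as a [k]-element ideal with an addable one. *)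
  under [LHS]eq_bigr => D /andP[iD /eqP Dk].
    rewrite expnS expn1 [X in (X * _)%N]nlinextE ?Dk // big_distrl /=.
    over.
  rewrite !pair_big_dep /=.
  rewrite (reindex_onto (fun p : {set B} * B => (p.2 |: p.1, p.2))
                        (fun p => (p.1 :\ p.2, p.2))) /=.
    apply: congr_big => //= -[D x] /=; last first.
      by move=> /andP[_ /eqP[->]].
    rewrite xpair_eqE eqxx andbT !inE eqxx /=.
    have [xD|xD] := boolP (x \in D); rewrite /= ?andbF.
      rewrite (_ : ((x |: D) :\ x == D) = false) ?andbF //.
      by apply/negbTE; apply: contraTneq xD => <-; rewrite !inE eqxx.
    rewrite setU1K // eqxx cardsU1 xD add1n eqSS !andbT.
    by case: (ideal D); rewrite ?andbF ?andbT // andbC.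
  move=> [D x] /= /andP[_]; rewrite inE => /andP[xD _].
  by rewrite setD1K.
under eq_bigr => D /andP[iD /eqP Dk].
  rewrite -big_distrr /= sum_nlinext_addable ?Dk // mulnCA mulnn.
  over.
rewrite -big_distrr /= IHk 1?ltnW //.
by rewrite factS expnS; lia.
Qed.

End LinearExtensions.

(** * Young diagrams *)

Lemma card_ord_lt n k : (k <= n)%N -> #|[set x : 'I_n | (x < k)%N]| = k.
Proof.
move=> kn; rewrite -sum1dep_card -(big_ord_widen n (fun=> 1%N) kn).
by rewrite sum1_card card_ord.
Qed.

Lemma downset_card n (S : {set 'I_n}) :
  (forall i j : 'I_n, j \in S -> (i <= j)%N -> i \in S) ->
  forall j, (j \in S) = (j < #|S|)%N.
Proof.
move=> dS j; apply/idP/idP => [jS|].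
  rewrite -(card_ord_lt (ltn_ord j)); apply: subset_leq_card.
  by apply/subsetP => i; rewrite inE ltnS; apply: dS.
apply: contraTT => jS; rewrite -leqNgt -[leqRHS](card_ord_lt (ltnW (ltn_ord j))).
apply: subset_leq_card; apply/subsetP => i iS; rewrite inE ltnNge.
by apply: contra jS; apply: dS.
Qed.

Section MultiDiagrams.

Variables r n : nat.
Local Notation cell := ('I_r * box n)%type.

(** The disjoint union of [r] copies of the square turns a tuple of diagrams into one order ideal,
    to which the counting of linear extensions applies. *)
Definition cell_le (x y : cell) :=
  [&& x.1 == y.1, (x.2.1 <= y.2.1)%N & (x.2.2 <= y.2.2)%N].

Definition ideal (D : {set cell}) :=
  [forall x, forall y, (y \in D) && cell_le x y ==> (x \in D)].

Lemma idealP (D : {set cell}) :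
  reflect (forall x y, y \in D -> cell_le x y -> x \in D) (ideal D).
Proof.
apply: (iffP 'forall_forallP) => iD x y; last by apply/implyP => /andP[]; apply: iD.
by move=> yD xy; have := iD x y; rewrite yD xy.
Qed.

Lemma ideal0 : ideal set0.
Proof. by apply/idealP => x y; rewrite inE. Qed.

Lemma idealI (D E : {set cell}) : ideal D -> ideal E -> ideal (D :&: E).
Proof.
move=> /idealP iD /idealP iE; apply/idealP => x y; rewrite !inE.
by move=> /andP[yD yE] xy; rewrite (iD x y) // (iE x y).
Qed.

Lemma idealU (D E : {set cell}) : ideal D -> ideal E -> ideal (D :|: E).
Proof.
move=> /idealP iD /idealP iE; apply/idealP => x y; rewrite !inE.
by move=> /orP[yD|yE] xy; [rewrite (iD x y)|rewrite (iE x y) // orbT].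
Qed.

(** The row index is a natural number, and rows outside the square have length 0, so that [i.+1] and
    [i.-1] need no bound. *)
Definition rowlen (D : {set cell}) (c : 'I_r) (i : nat) :=
  #|[set j : 'I_n | [exists i' : 'I_n, (i' == i :> nat) && ((c, (i', j)) \in D)]]|.

Section Ideal.

Variables (D : {set cell}).
Hypothesis iD : ideal D.

Lemma mem_rowlen c (i j : 'I_n) : ((c, (i, j)) \in D) = (j < rowlen D c i)%N.
Proof.
rewrite -downset_card ?inE => [|j1 j2].
  apply/idP/existsP => [ijD|[i' /andP[/eqP/val_inj->]] //].
  by exists i; rewrite eqxx.
rewrite !inE => /existsP[i' /andP[/eqP ii' D2]] j12.
apply/existsP; exists i'; rewrite ii' eqxx.
by apply: (idealP _ iD) D2 _; rewrite /cell_le /= eqxx leqnn.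
Qed.

Lemma rowlen_geq c i : (n <= i)%N -> rowlen D c i = 0%N.
Proof.
move=> ni; apply: eq_card0 => j; rewrite inE; apply/negbTE/existsP => -[i'].
by have := ltn_ord i'; case: eqP => // ->; rewrite ltnNge ni.
Qed.

Lemma rowlen_le c i j : (i <= j)%N -> (rowlen D c j <= rowlen D c i)%N.
Proof.
move=> ij; apply: subset_leq_card; apply/subsetP => k.
rewrite !inE => /existsP[j' /andP[/eqP jj' D2]].
have ini : (i < n)%N by rewrite (leq_ltn_trans ij) // -jj'.
apply/existsP; exists (Ordinal ini); rewrite eqxx.
by apply: (idealP _ iD) D2 _; rewrite /cell_le /= eqxx leqnn jj' ij.
Qed.

Lemma rowlen_max c i : (rowlen D c i <= n)%N.
Proof. by rewrite -[leqRHS]card_ord max_card. Qed.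

Lemma addableE c (i j : 'I_n) : ((c, (i, j)) \in addable ideal D) =
  (j == rowlen D c i :> nat) && ((i == 0%N :> nat) || (rowlen D c i < rowlen D c i.-1)%N).
Proof.
rewrite inE mem_rowlen -leqNgt; apply/andP/andP => [[lj /idealP iDx]|[/eqP jE i0]].
  have jE : nat_of_ord j = rowlen D c i.
    apply/eqP; rewrite eqn_leq lj andbT leqNgt; apply/negP => jl.
    have ln : (rowlen D c i < n)%N by apply: ltn_trans jl _.
    have /idPn[] : (c, (i, Ordinal ln)) \in (c, (i, j)) |: D.
      apply: iDx (setU11 _ _) _; rewrite /cell_le /= eqxx leqnn /=; exact: ltnW.
    rewrite !inE mem_rowlen ltnn orbF !xpair_eqE !eqxx /=.
    by rewrite -val_eqE neq_ltn jl.
  split; first exact/eqP.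
  case: posnP => [//|i0] /=.
  have i1n : (i.-1 < n)%N by rewrite (leq_ltn_trans (leq_pred _)).
  have : (c, (Ordinal i1n, j)) \in (c, (i, j)) |: D.
    apply: iDx (setU11 _ _) _; rewrite /cell_le /= eqxx leqnn andbT /=; exact: leq_pred.
  rewrite !inE mem_rowlen -jE => /orP[|//].
  rewrite !xpair_eqE -!val_eqE /= eqxx eqxx andbT /=; lia.
split; first by rewrite jE.
apply/idealP => -[c' [i' j']] y; rewrite !inE => /orP[/eqP->|yD]; last first.
  by move=> /(idealP _ iD _ _ yD)->; rewrite orbT.
case/and3P=> /eqP /= -> i'i j'j; rewrite !xpair_eqE eqxx mem_rowlen /=.
move: i'i; rewrite leq_eqVlt => /orP[/eqP/val_inj->|i'i].
  by rewrite eqxx /= -jE -val_eqE /= -leq_eqVlt.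
apply/orP; right; rewrite (leq_ltn_trans j'j) // jE.
case/orP: i0 => [/eqP i0|li]; first by rewrite i0 in i'i.
by apply: leq_trans li _; apply: rowlen_le; rewrite -ltnS (ltn_predK i'i).
Qed.

Lemma removableE c (i j : 'I_n) : ((c, (i, j)) \in removable ideal D) =
  (j.+1 == rowlen D c i :> nat) && (rowlen D c i.+1 < rowlen D c i)%N.
Proof.
rewrite inE mem_rowlen; apply/andP/andP => [[lj /idealP iDx]|[/eqP jE i0]].
  have xD y : cell_le (c, (i, j)) y -> y != (c, (i, j)) -> y \notin D.
    move=> xy yx; apply/negP => yD.
    by have := iDx (c, (i, j)) y; rewrite !inE eqxx yx => /(_ yD xy).
  have jE : j.+1 = rowlen D c i.
    apply/eqP; rewrite eqn_leq lj leqNgt; apply/negP => jl.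
    have ln : (j.+1 < n)%N by apply: leq_trans jl (rowlen_max _ _).
    have := xD (c, (i, Ordinal ln)).
    rewrite mem_rowlen jl /cell_le /= eqxx leqnn leqnSn /= => /(_ isT).
    by rewrite !xpair_eqE -!val_eqE /= !eqxx (gtn_eqF (leqnn _)) => /(_ isT).
  rewrite jE eqxx -jE; split=> //; rewrite ltnNge; apply/negP => jl.
  have [ni|ini] := leqP n i.+1; first by rewrite rowlen_geq in jl.
  have := xD (c, (Ordinal ini, j)).
  rewrite mem_rowlen jl /cell_le /= eqxx leqnn leqnSn /= => /(_ isT).
  by rewrite !xpair_eqE -!val_eqE /= !eqxx (gtn_eqF (leqnn _)) => /(_ isT).
split; first by rewrite -jE.
apply/idealP => x [c' [i' j']]; rewrite !inE => /andP[yx yD] xy.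
rewrite (idealP _ iD _ _ yD) // andbT; apply: contra yx => /eqP xE.
move: xy yD; rewrite xE => /and3P[/eqP/= <- ii' jj']; rewrite mem_rowlen.
move: ii'; rewrite leq_eqVlt => /orP[/eqP/val_inj<-|i'i] lj'.
  rewrite !xpair_eqE !eqxx -val_eqE /= eqn_leq jj' andbT.
  by rewrite -ltnS jE.
have := leq_trans lj' (rowlen_le c i'i); lia.
Qed.

(** Within one component, row [i] has a removable box when it is longer than row [i.+1], and row
    [i.+1] has an addable box under the same condition. Row 0 always has one more addable box,
    whence one extra per component. With fewer than [n] boxes, no row is full and row [n.-1] is
    empty, so the square hides none of these boxes. *)
Lemma addable_removable : (#|D| < n)%N ->
  #|addable ideal D| = (#|removable ideal D| + r)%N.
Proof.
move=> Dn; have := leq_ltn_trans (leq0n _) Dn; pose n' := n.-1 => /prednK/esym.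
rewrite -/n' => n0.
have l0 c : rowlen D c n' = 0%N.
  apply/eqP; rewrite -leqn0 leqNgt; apply/negP => l0.
  have nn' : (n' < n)%N by rewrite n0.
  have nD : (c, (Ordinal nn', Ordinal (leq_ltn_trans (leq0n _) nn'))) \in D.
    by rewrite mem_rowlen.
  move: Dn; rewrite ltnNge => /negP[].
  pose f (i : 'I_n) : cell := (c, (i, Ordinal (leq_ltn_trans (leq0n _) nn'))).
  have f_inj : injective f by move=> i j [].
  rewrite -[leqLHS]card_ord -[leqLHS](card_imset _ f_inj).
  apply: subset_leq_card; apply/subsetP => _ /imsetP[i _ ->].
  apply: (idealP _ iD) nD _; rewrite /cell_le /= eqxx leqnn andbT /=.
  by rewrite -ltnS -n0.
have ln c : (rowlen D c 0 < n)%N.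
  apply: leq_ltn_trans Dn; rewrite /rowlen.
  have nn' : (0 < n)%N by rewrite n0.
  pose f (j : 'I_n) : cell := (c, (Ordinal nn', j)).
  have f_inj : injective f by move=> i j [].
  rewrite -[leqLHS](card_imset _ f_inj).
  apply: subset_leq_card; apply/subsetP => _ /imsetP[j + ->].
  rewrite inE => /existsP[i' /andP[/eqP i0]].
  by rewrite (_ : i' = Ordinal nn') //; apply: val_inj.
have cardE (A : {set cell}) :
    #|A| = (\sum_(c < r) \sum_(i < n) \sum_(j < n | (c, (i, j)) \in A) 1)%N.
  rewrite -sum1_card !pair_big_dep /=.
  rewrite (reindex (fun p : 'I_r * 'I_n * 'I_n => (p.1.1, (p.1.2, p.2)))) //=.
  by exists (fun x => (x.1, x.2.1, x.2.2)) => [[[] ]|[? []]].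
rewrite !cardE -[X in (_ = _ + X)%N]card_ord -sum1_card -big_split /=.
apply: eq_bigr => c _.
have -> : (\sum_(i < n) \sum_(j < n | (c, (i, j)) \in addable ideal D) 1 =
           \sum_(i < n) ((i == 0%N :> nat) || (rowlen D c i < rowlen D c i.-1)))%N.
  apply: eq_bigr => i _; under eq_bigl do rewrite addableE.
  have ri : (rowlen D c i < n)%N by apply: leq_ltn_trans (ln c); apply: rowlen_le.
  case: (_ || _); last by rewrite big1 // => j; rewrite andbF.
  by rewrite (big_pred1 (Ordinal ri)) // => j; rewrite /= andbT -val_eqE.
have -> : (\sum_(i < n) \sum_(j < n | (c, (i, j)) \in removable ideal D) 1 =
           \sum_(i < n) (rowlen D c i.+1 < rowlen D c i))%N.
  apply: eq_bigr => i _; under eq_bigl do rewrite removableE.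
  case lt: (_ < _)%N; last by rewrite big1 // => j; rewrite andbF.
  have ri : ((rowlen D c i).-1 < n)%N.
    rewrite (leq_ltn_trans (leq_pred _)) // (leq_ltn_trans _ (ln c)) //.
    exact: rowlen_le.
  rewrite (big_pred1 (Ordinal ri)) // => j; rewrite /= andbT -val_eqE /=.
  by rewrite -[RHS]eqSS (ltn_predK lt).
have sumE (f : nat -> nat) : (\sum_(i < n) f i = \sum_(0 <= i < n'.+1) f i)%N.
  by rewrite -n0 big_mkord.
rewrite (sumE (fun i => nat_of_bool ((i == 0%N) || (rowlen D c i < rowlen D c i.-1)%N))).
rewrite (sumE (fun i => nat_of_bool (rowlen D c i.+1 < rowlen D c i)%N)).
rewrite big_nat_recl // big_nat_recr //= l0 ltn0 addn0 addnC.
by congr addn.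
Qed.

End Ideal.

Definition mdiag_of (D : {set cell}) : multidiag r n :=
  [ffun c => [set b | (c, b) \in D]].

Lemma mdiag_of_inj : injective mdiag_of.
Proof.
move=> D E DE; apply/setP => -[c b].
have /setP/(_ b) := congr1 (fun f : multidiag r n => f c) DE.
by rewrite !ffunE !inE.
Qed.

Lemma mdiag_of_calY (D : {set cell}) : ideal D -> #|D| = n -> mdiag_of D \in calY r n.
Proof.
move=> /idealP iD Dn; rewrite inE; apply/andP; split.
  apply/forallP => c; apply/forall_inP => b; rewrite ffunE inE => bD.
  apply/forallP => b'; apply/implyP => /andP[b1 b2]; rewrite inE.
  by apply: iD bD _; rewrite /cell_le eqxx b1 b2.
rewrite -[X in _ == X]Dn -[X in _ == X]sum1_card.
rewrite (reindex (fun p : 'I_r * box n => (p.1, p.2))); last first.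
  by exists id => -[].
rewrite -(pair_big_dep xpredT (fun c b => (c, b) \in D) (fun _ _ => 1%N)) /=.
apply/eqP/eq_bigr => c _; rewrite -sum1_card; apply: eq_bigl => b.
by rewrite ffunE inE.
Qed.

(** The label of a box is its position in [s]. For an absent box [index] returns [size s], which is
    [n] in all uses, so [insub] yields [None]. *)
Definition tab_of (s : seq cell) : tableau r n :=
  [ffun c => [ffun b => insub (index (c, b) s)]].

Lemma tab_ofE s c b : tab_of s c b = insub (index (c, b) s).
Proof. by rewrite !ffunE. Qed.

Lemma insub_ordE m (k : 'I_n) : (insub m == Some k :> option 'I_n) = (m == k).
Proof.
case: insubP => [u _ <-|]; first by rewrite (inj_eq Some_inj).
by move=> nm; apply/esym/negbTE; apply: contra nm => /eqP->.
Qed.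

Lemma linext_tab (D : {set cell}) s : ideal D -> #|D| = n -> s \in linext ideal n D ->
  tab_of s \in Tab (mdiag_of D).
Proof.
move=> iD Dn sL; have sn := size_linext Dn sL; have sD := mem_linext Dn sL.
have us : uniq s by apply/card_uniqP; rewrite (eq_card sD) Dn sn.
rewrite inE; apply/and3P; split.
- apply/'forall_forallP => c b; rewrite !ffunE inE -sD -index_mem sn.
  by case: insubP => [? ->|/negPf->].
- apply/forallP => k; have ks : (k < size s)%N by rewrite sn.
  have /hasP[x0 _ _] : has predT s by rewrite has_predT; case: (s) ks.
  rewrite -(cards1 (nth x0 s k)); apply/eqP/eq_card => -[c b].
  rewrite !inE !ffunE insub_ordE; apply/eqP/eqP => [e|->].
    by rewrite -e nth_index // -index_mem e.
  by rewrite index_uniq.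
apply/forallP => c; apply/'forall_forallP => b b'.
apply/forallP => k; apply/forallP => k'; apply/implyP.
move=> /and3P[/eqP + /eqP + lt]; rewrite !tab_ofE.
move=> /eqP; rewrite insub_ordE => /eqP bk /eqP; rewrite insub_ordE => /eqP bk'.
have b's : (c, b') \in s by rewrite -index_mem bk' sn.
(* The prefix of length [k'.+1] is an ideal containing [(c, b')], hence also [(c, b)], which bounds
   the position of the latter. *)
have /idealP/(_ (c, b) (c, b')) := linext_prefix_ideal Dn iD sL (ltn_ord k').
rewrite !inE in_take // bk' => /(_ (leqnn _)) bT.
have /bT/index_ltn : cell_le (c, b) (c, b').
  by rewrite /cell_le eqxx /=; case/orP: lt => /andP[/eqP-> /ltnW->]; rewrite leqnn.
rewrite bk ltnS leq_eqVlt => /orP[/eqP kk'|//].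
have [bb'] : (c, b) = (c, b').
  by rewrite -(nth_index (c, b) b's) bk' -kk' -bk nth_index // -index_mem bk sn.
by move: lt; rewrite bb' !ltnn !andbF.
Qed.

Lemma tab_of_inj (D : {set cell}) : #|D| = n -> {in linext ideal n D &, injective tab_of}.
Proof.
move=> Dn s t sL tL st.
have sn := size_linext Dn sL; have tn := size_linext Dn tL.
have sD := mem_linext Dn sL.
have us : uniq s by apply/card_uniqP; rewrite (eq_card sD) Dn sn.
have tD := mem_linext Dn tL.
case: s => [|x0 s] in sL st sn sD us *; first by case: (t) tn; rewrite -sn.
apply: (@eq_from_nth _ x0) => [|i]; rewrite sn ?tn // => lt_in.
set x := nth _ _ _.
have /eqP : tab_of (x0 :: s) x.1 x.2 = Some (Ordinal lt_in).
  by apply/eqP; rewrite !ffunE insub_ordE -surjective_pairing index_uniq ?sn.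
rewrite st !ffunE insub_ordE -surjective_pairing => /eqP /= <-.
by rewrite nth_index // tD -sD mem_nth ?sn.
Qed.

Lemma nlinext_Tab (D : {set cell}) : ideal D -> #|D| = n ->
  (nlinext ideal D <= #|Tab (mdiag_of D)|)%N.
Proof.
move=> iD Dn; rewrite /nlinext Dn -(size_map tab_of) cardE; apply: uniq_leq_size.
  by rewrite map_inj_in_uniq ?linext_uniq //; apply: tab_of_inj.
by move=> _ /mapP[s sL ->]; rewrite mem_enum linext_tab.
Qed.

Lemma sum_Tab_sqr : (r ^ n * n`! <= \sum_(la in calY r n) #|Tab la| ^ 2)%N.
Proof.
rewrite -(sum_nlinext_sqr idealI idealU addable_removable ideal0 (leqnn n)).
pose A := [set D : {set cell} | ideal D && (#|D| == n)].
apply: (@leq_trans (\sum_(la in [set mdiag_of D | D in A]) #|Tab la| ^ 2)).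
  rewrite big_imset /=; last by move=> ? ? _ _; apply: mdiag_of_inj.
  rewrite [leqRHS](eq_bigl (fun D => ideal D && (#|D| == n))); last by move=> D; rewrite inE.
  apply: leq_sum => D /andP[iD /eqP Dn].
  by rewrite leq_sqr nlinext_Tab.
rewrite [leqRHS](big_setID [set mdiag_of D | D in A]) /=.
rewrite (setIidPr _) ?leq_addr //; apply/subsetP => _ /imsetP[D + ->].
by rewrite inE => /andP[iD /eqP]; apply: mdiag_of_calY.
Qed.

End MultiDiagrams.

(** * Shifts and standard tableaux *)

Section Shift.

Variable r : nat.

Lemma iter_ordS k (c : 'I_r) : iter k (@ordS r) c = ((c + k) %% r)%N :> nat.
Proof.
elim: k => [|k IHk]; first by rewrite addn0 modn_small.
by rewrite iterS /= IHk -[(_ %% r).+1]addn1 modnDml addn1 addnS.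
Qed.

Lemma eq_iter_ordS j k (c : 'I_r) : j = k %[mod r] ->
  iter j (@ordS r) c = iter k (@ordS r) c.
Proof. by move=> jk; apply: val_inj; rewrite /= !iter_ordS -modnDmr jk modnDmr. Qed.

Variable A : Type.

Lemma iter_shE k (a : {ffun 'I_r -> A}) c : iter k (@sh r A) a (iter k (@ordS r) c) = a c.
Proof. by elim: k => //= k IHk; rewrite ffunE ordSK. Qed.

Lemma iter_shVE k (a : {ffun 'I_r -> A}) c : iter k (@shV r A) a c = a (iter k (@ordS r) c).
Proof. by elim: k c => //= k IHk c; rewrite ffunE IHk -iterSr. Qed.

Lemma iter_shK k : cancel (iter k (@sh r A)) (iter k (@shV r A)).
Proof. by move=> a; apply/ffunP => c; rewrite iter_shVE iter_shE. Qed.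

Lemma iter_shVK k : cancel (iter k (@shV r A)) (iter k (@sh r A)).
Proof. by elim: k => // k IHk a; rewrite iterSr iterS shVK IHk. Qed.

Lemma eq_iter_sh j k (a : {ffun 'I_r -> A}) : j = k %[mod r] ->
  iter j (@sh r A) a = iter k (@sh r A) a.
Proof.
move=> jk; apply: (can_inj (iter_shVK j)); rewrite iter_shK; apply/ffunP => c.
by rewrite iter_shVE (eq_iter_ordS c jk) iter_shE.
Qed.

Lemma iter_sh_dvd k (a : {ffun 'I_r -> A}) : (r %| k)%N -> iter k (@sh r A) a = a.
Proof. by move=> rk; rewrite (@eq_iter_sh _ 0) // mod0n; apply/eqP. Qed.

Lemma iter_sh_inj k : injective (iter k (@sh r A)).
Proof. exact: can_inj (iter_shK k). Qed.

End Shift.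

Lemma iter_iter (T : Type) (f : T -> T) a b x : iter a (iter b f) x = iter (a * b) f x.
Proof. by elim: a => //= a ->; rewrite mulSn iterD. Qed.

Section Tableaux.

Variables r n : nat.
Implicit Types (la mu : multidiag r n) (S T : tableau r n).

Lemma Tab_mem la T c b : T \in Tab la -> (T c b != None) = (b \in la c).
Proof. by rewrite inE => /and3P[/'forall_forallP/(_ c b)/eqP]. Qed.

Lemma Tab_unique la T c b c' b' k : T \in Tab la ->
  T c b = Some k -> T c' b' = Some k -> c = c' /\ b = b'.
Proof.
rewrite inE => /and3P[_ /forallP/(_ k)/cards1P[[c0 b0] /setP E] _] Tb Tb'.
have := E (c, b); have := E (c', b'); rewrite !inE /= Tb Tb' eqxx.
by move=> /esym/eqP[-> ->] /esym/eqP[-> ->].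
Qed.

Lemma Tab_ex la T k : T \in Tab la -> exists c b, T c b = Some k.
Proof.
rewrite inE => /and3P[_ /forallP/(_ k)/cards1P[[c b] /setP E] _].
by exists c, b; have := E (c, b); rewrite !inE /= eqxx => /eqP.
Qed.

Lemma Tab_shape la mu T : T \in Tab la -> T \in Tab mu -> la = mu.
Proof.
move=> Tla Tmu; apply/ffunP => c; apply/setP => b.
by rewrite -(Tab_mem _ _ Tla) (Tab_mem _ _ Tmu).
Qed.

Lemma Tab_increasing la T c (b b' : box n) k k' : T \in Tab la ->
  T c b = Some k -> T c b' = Some k' ->
  ((b.1 == b'.1) && (b.2 < b'.2)%N) || ((b.2 == b'.2) && (b.1 < b'.1)%N) ->
  (k < k')%N.
Proof.
rewrite inE => /and3P[_ _ /forallP/(_ c)/forallP/(_ b)/forallP/(_ b')].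
move=> /forallP/(_ k)/forallP/(_ k')/implyP incr Tb Tb' bb'.
by apply: incr; rewrite Tb Tb' !eqxx bb'.
Qed.

Lemma calY_young la c (b b' : box n) : la \in calY r n -> b \in la c ->
  (b'.1 <= b.1)%N -> (b'.2 <= b.2)%N -> b' \in la c.
Proof.
rewrite inE => /andP[/forallP/(_ c)/forall_inP yla _] bla b1 b2.
by have /forallP/(_ b') := yla b bla; rewrite b1 b2.
Qed.

(** Two distinct boxes of one diagonal are in this position. Labels grow along the row from [b] to
    the corner [(b.1, b'.2)], then down the column to [b']. *)
Lemma Tab_northwest la T c (b b' : box n) k : la \in calY r n -> T \in Tab la ->
  T c b' = Some k -> (b.1 < b'.1)%N -> (b.2 < b'.2)%N ->
  exists2 k' : 'I_n, (k' < k)%N & T c b = Some k'.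
Proof.
move=> laY Tla Tb' b1 b2.
have b'la : b' \in la c by rewrite -(Tab_mem _ _ Tla) Tb'.
have bla := calY_young laY b'la (ltnW b1) (ltnW b2).
have : (b.1, b'.2) \in la c by apply: (calY_young laY b'la) => //=; apply: ltnW.
rewrite -(Tab_mem _ _ Tla); case Tm : (T c _) => [k1|//] _.
move: bla; rewrite -(Tab_mem _ _ Tla); case Tb : (T c b) => [k0|//] _.
exists k0 => //; apply: (@leq_ltn_trans k1).
  by apply/ltnW/(Tab_increasing Tla Tb Tm); rewrite eqxx b2.
by apply: (Tab_increasing Tla Tm Tb'); rewrite /= eqxx b1 orbT.
Qed.

(* By induction on the label [k]: if [T] and [S] agree below [k] but put [k] on
   different boxes of one diagonal, the upper of the two boxes carries a label
   smaller than [k] in the other tableau, contradicting the agreement. *)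
Lemma Tab_weight_inj la mu T S : la \in calY r n -> mu \in calY r n ->
  T \in Tab la -> S \in Tab mu ->
  (forall k c c' (b b' : box n), T c b = Some k -> S c' b' = Some k ->
     c = c' /\ (b.2 + b'.1 = b'.2 + b.1)%N) ->
  T = S.
Proof.
move=> laY muY TT SS wTS.
have half mu' (T' S' : tableau r n) (k : 'I_n) c (b b' : box n) :
    mu' \in calY r n -> S' \in Tab mu' -> (forall k, exists c b, T' c b = Some k) ->
    (forall k' : 'I_n, (k' < k)%N ->
      forall c c' b b', T' c b = Some k' -> S' c' b' = Some k' ->
      c = c' /\ b = b') ->
    T' c b = Some k -> S' c b' = Some k ->
    (b.2 + b'.1 = b'.2 + b.1)%N -> (b.1 < b'.1)%N -> False.
  move=> mu'Y SS' exT IH Tb Sb' ct b1.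
  have [|k' k'k Sb] := Tab_northwest mu'Y SS' Sb' b1; first by lia.
  have [c2 [b2 Tb2]] := exT k'.
  have [cc2 bb2] := IH k' k'k _ _ _ _ Tb2 Sb; subst c2 b2.
  by move: k'k; move: Tb; rewrite Tb2 => -[->]; rewrite ltnn.
have pos (k : 'I_n) :
    forall c c' b b', T c b = Some k -> S c' b' = Some k -> c = c' /\ b = b'.
  have [j] := ubnP k; elim: j k => // j IHj k kj c c' b b' Tb Sb'.
  have IH (k' : 'I_n) : (k' < k)%N ->
      forall c c' b b', T c b = Some k' -> S c' b' = Some k' ->
      c = c' /\ b = b'.
    by move=> k'k; apply: IHj; apply: leq_trans k'k _.
  have [cc' ct] := wTS _ _ _ _ _ Tb Sb'; subst c'; split=> //.
  case: (ltngtP b.1 b'.1) => b1.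
  - by case: (half mu T S k c b b') => // k'; apply: Tab_ex TT.
  - case: (half la S T k c b' b) => //.
      by move=> k'; apply: Tab_ex SS.
    by move=> k' k'k c1 c2 b3 b4 Sb Tb3; have [-> ->] := IH k' k'k _ _ _ _ Tb3 Sb.
  - have b2 : b.2 = b'.2 :> nat by move: ct; rewrite b1 => /addIn.
    by case: b b' b1 b2 {Tb Sb' ct} => [i j'] [i' j''] /= /val_inj-> /val_inj->.
have sub (T' S' : tableau r n) c b (k : 'I_n) : (exists c b, S' c b = Some k) ->
    (forall c c' b b', T' c b = Some k -> S' c' b' = Some k -> c = c' /\ b = b') ->
    T' c b = Some k -> S' c b = Some k.
  by move=> [c' [b' Sb']] H Tb; have [-> ->] := H _ _ _ _ Tb Sb'.
apply/ffunP => c; apply/ffunP => b.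
case Tb : (T c b) => [k|]; first exact/esym/(sub T S c b k (Tab_ex k SS) (pos k) Tb).
case Sb : (S c b) => [k|] //; rewrite -Tb; apply: (sub S _ _ _ _ (Tab_ex k TT) _ Sb).
by move=> c1 c2 b1 b2 S1 T2; have [-> ->] := pos k _ _ _ _ T2 S1.
Qed.

Lemma Tab_sh la T : T \in Tab la -> sh T \in Tab (sh la).
Proof.
rewrite !inE => /and3P[/'forall_forallP T1 /forallP T2 /forallP T3].
apply/and3P; split.
- apply/forallP => c; apply/forallP => b; rewrite !ffunE; exact: T1.
- apply/forallP => k; apply/eqP; rewrite -(eqP (T2 k)).
  rewrite -[RHS](card_imset _ (f := fun cb => (ordS cb.1, cb.2))); last first.
    move=> [c b] [c' b'] /= E; have /= -> := congr1 snd E.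
    by have /= /(can_inj (@ordSK r))-> := congr1 fst E.
  apply/eq_card => -[c b]; apply/idP/imsetP => [|[[c' b']]].
    by rewrite !inE ffunE => cT; exists (ord_pred c, b); rewrite ?inE // ord_predK.
  by rewrite !inE /= => T' [-> ->]; rewrite ffunE ordSK.
- by apply/forallP => c; rewrite ffunE.
Qed.

Lemma Tab_iter_sh k la T : T \in Tab la ->
  iter k (@sh r _) T \in Tab (iter k (@sh r _) la).
Proof. by move=> TT; elim: k => //= k IHk; apply: Tab_sh. Qed.

Lemma calY_sh la : la \in calY r n -> sh la \in calY r n.
Proof.
rewrite !inE => /andP[/forallP y /eqP lan]; apply/andP; split.
  by apply/forallP => c; rewrite ffunE.
rewrite -[X in _ == X]lan (reindex_inj (can_inj (@ordSK r))).
by apply/eqP/eq_bigr => c _; rewrite ffunE ordSK.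
Qed.

Lemma calY_iter_sh k la : la \in calY r n -> iter k (@sh r _) la \in calY r n.
Proof. by move=> laY; elim: k => //= k IHk; apply: calY_sh. Qed.

End Tableaux.

Import GRing.Theory Num.Theory.
Local Open Scope ring_scope.

(** * Weights of the Gelfand-Tsetlin basis *)

Lemma prim_root_neq0 (F : fieldType) r (z : F) : r.-primitive_root z -> z != 0.
Proof.
move=> prz; apply/eqP => z0; have := prim_expr_order prz.
by rewrite z0 expr0n gtn_eqF ?(prim_order_gt0 prz) // => /esym/eqP; rewrite oner_eq0.
Qed.

Section Group.

Variables (F : numClosedFieldType) (r n : nat) (z : F).
Hypothesis prz : r.-primitive_root z.
Local Notation gT := (Gr1n prz n).
Implicit Types g h : gT.

Lemma gr1n_permP g : exists s : 'S_n,
  (forall i, g i (s i) \in cycG r z) /\ (forall i j, j != s i -> g i j = 0).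
Proof. exact/gperm_mxP/gr1n_mxP. Qed.

Lemma delta0E g (s : 'S_n) : (forall i, g i (s i) \in cycG r z) ->
  (forall i j, j != s i -> g i j = 0) -> delta0 g = \prod_i g i (s i).
Proof.
move=> s1 s2; apply: eq_bigr => i _; rewrite (big_pred1 (s i)) // => j /=.
have [->|/s2->] := eqVneq j (s i); first by rewrite (cycG_neq0 prz).
by rewrite eqxx.
Qed.

Lemma delta0_unity g : delta0 g ^+ r = 1.
Proof.
have [s [s1 s2]] := gr1n_permP g; rewrite (delta0E s1 s2) -prodrXl big1 // => i _.
by apply/eqP; rewrite -(cycGE prz).
Qed.

Lemma delta0_neq0 g : delta0 g != 0.
Proof. by rewrite (cycG_neq0 prz) // cycGE // delta0_unity. Qed.

Lemma delta0_zeta g : exists k, delta0 g = z ^+ k.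
Proof. by have [k ->] := prim_rootP prz (delta0_unity g); exists k. Qed.

Lemma delta0_1 : delta0 (1%g : gT) = 1.
Proof.
apply: (mulfI (delta0_neq0 1%g)).
by rewrite -delta0M mulg1 mulr1.
Qed.

Lemma delta0V g : delta0 g^-1%g = (delta0 g)^-1.
Proof.
apply: (mulfI (delta0_neq0 g)).
by rewrite -delta0M mulgV delta0_1 divff // delta0_neq0.
Qed.

Lemma delta0X g k : delta0 (g ^+ k)%g = delta0 g ^+ k.
Proof.
elim: k => [|k IHk]; first by rewrite expg0 expr0 delta0_1.
by rewrite expgS exprS delta0M IHk.
Qed.

Lemma zetagE (i j k : 'I_n) :
  zetag prz i j k = if j == k then (if j == i then z else 1) else 0 :> F.
Proof. by rewrite !mxE; case: (j =P k) => [->|]; rewrite ?mulr1n ?mulr0n. Qed.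

Lemma delta0_zetag (i : 'I_n) : delta0 (zetag prz i : gT) = z.
Proof.
rewrite (@delta0E _ 1%g).
- rewrite (bigD1 i) //= perm1 zetagE !eqxx big1 ?mulr1 // => j /negPf ji.
  by rewrite perm1 zetagE eqxx ji.
- move=> j; rewrite perm1 zetagE eqxx (cycGE prz).
  by case: ifP; rewrite ?expr1n ?(prim_expr_order prz).
- by move=> j k; rewrite perm1 zetagE eq_sym => /negPf->.
Qed.

Lemma delta0_sg (i j : 'I_n) : delta0 (sg prz i j : gT) = 1.
Proof.
have sgE k l : sg prz i j k l = (tperm i j k == l)%:R :> F by rewrite !mxE.
rewrite (@delta0E _ (tperm i j)).
- by rewrite big1 // => k _; rewrite sgE eqxx.
- by move=> k; rewrite sgE eqxx (cycGE prz) expr1n.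
- by move=> k l; rewrite sgE eq_sym => /negPf->.
Qed.

End Group.

Section Bases.

Variables (F : numClosedFieldType) (r n d : nat) (la : multidiag r n).
Variable v : tableau r n -> 'rV[F]_d.
Local Notation tmx := (tab_mx la v).

Lemma mul_tab_mx (u : 'rV_#|Tab la|) : u *m tmx = \sum_k u 0 k *: v (enum_val k).
Proof. by rewrite mulmx_sum_row; apply: eq_bigr => k _; rewrite rowK. Qed.

Lemma tab_span m (M N : 'M[F]_(d, m)) : row_full tmx ->
  (forall T, T \in Tab la -> v T *m M = v T *m N) -> M = N.
Proof.
move=> fu MN; apply: (row_full_inj fu); apply/row_matrixP => k.
by rewrite !row_mul rowK MN // enum_valP.
Qed.

Lemma tab_free (a : tableau r n -> F) : row_free tmx ->
  \sum_(T in Tab la) a T *: v T = 0 -> forall T, T \in Tab la -> a T = 0.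
Proof.
move=> fr a0 T TT; pose u : 'rV_#|Tab la| := \row_k a (enum_val k).
have : u *m tmx = 0.
  rewrite mul_tab_mx -[RHS]a0 (big_enum_val (fun T => a T *: v T)).
  by apply: eq_bigr => k _; rewrite mxE.
move/eqP; rewrite (mulmx_free_eq0 _ fr) => /eqP/rowP/(_ (enum_rank_in TT T)).
by rewrite !mxE enum_rankK_in.
Qed.

Lemma tab_neq0 T : row_free tmx -> T \in Tab la -> v T != 0.
Proof.
move=> fr TT; apply/eqP => v0.
have /tab_free-/(_ fr T TT)/eqP : \sum_(S in Tab la) (S == T)%:R *: v S = 0.
  rewrite (bigD1 T) //= v0 scaler0 add0r big1 // => S /andP[_ /negPf->].
  by rewrite scale0r.
by rewrite eqxx oner_eq0.
Qed.

(** An eigenvector of a diagonal operator is supported on basis vectors with the same eigenvalue: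
    freeness kills each coefficient [u_l * (e_l - x)]. *)
Lemma tab_eigen (M : 'M_d) (e : tableau r n -> F) (u : 'rV_#|Tab la|) x :
  row_free tmx -> (forall T, T \in Tab la -> v T *m M = e T *: v T) ->
  u *m tmx *m M = x *: (u *m tmx) -> forall k, u 0 k != 0 -> e (enum_val k) = x.
Proof.
move=> fr eM uM k uk.
have : (\row_l (u 0 l * (e (enum_val l) - x))) *m tmx = 0.
  rewrite mul_tab_mx; under eq_bigr => l _.
    rewrite mxE mulrBr scalerBl (mulrC _ x) -[x * _ *: _]scalerA -scalerA -eM ?enum_valP //.
    over.
  rewrite sumrB -scaler_sumr -mul_tab_mx -uM mul_tab_mx mulmx_suml.
  by rewrite -sumrB big1 // => l _; rewrite scalemxAl subrr.
move/eqP; rewrite (mulmx_free_eq0 _ fr) => /eqP/rowP/(_ k); rewrite !mxE => /eqP.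
by rewrite mulf_eq0 (negPf uk) subr_eq0 => /eqP.
Qed.

End Bases.

Section Weights.

Variables (F : numClosedFieldType) (r n : nat) (z : F).
Hypothesis prz : r.-primitive_root z.
Local Notation gT := (Gr1n prz n).

Lemma GT_zetag d (rho : mx_representation F [set: gT] d) la v T c b k :
  GT_basis rho la v -> T \in Tab la -> T c b = Some k ->
  v T *m rho (zetag prz k) = z ^+ c *: v T.
Proof.
move=> GT TT Tk; rewrite (GT_diag GT) //; last first.
  by apply/is_diag_mxP => i j ij; rewrite (zetagE prz) ifN.
congr (_ *: _); rewrite (bigD1 k) //= [X in _ * X]big1 => [|l lk]; last first.
  by rewrite big1 // => c' _; rewrite (zetagE prz) eqxx (negPf lk) expr1n.
rewrite mulr1 (big_pred1 c) => [|c' /=]; first by rewrite (zetagE prz) !eqxx.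
apply/codomP/eqP => [[b' e]|->]; last by exists b.
by have [] := Tab_unique TT Tk (esym e).
Qed.

Variables (d1 d2 : nat) (rho1 : mx_representation F [set: gT] d1).
Variables (rho2 : mx_representation F [set: gT] d2).

(** Each summand of a Jucys-Murphy element has [delta0] equal to 1, the powers of [zeta_i] and
    [zeta_j] cancelling, so the twist is invisible to it. *)
Lemma twisted_JM e (phi : 'M_(d1, d2)) k :
  (forall g, rho1 g *m phi = delta0 g ^+ e *: (phi *m rho2 g)) ->
  JM rho1 k *m phi = phi *m JM rho2 k.
Proof.
move=> phiP; rewrite mulmx_suml mulmx_sumr; apply: eq_bigr => i _.
rewrite mulmx_suml mulmx_sumr; apply: eq_bigr => l _.
rewrite phiP !delta0M delta0V !delta0X !delta0_zetag delta0_sg mulr1.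
by rewrite mulfV ?expr1n ?scale1r // expf_neq0 // (prim_root_neq0 prz).
Qed.

Variables (la mu : multidiag r n) (v1 : tableau r n -> 'rV[F]_d1).
Variable (v2 : tableau r n -> 'rV[F]_d2).
Hypotheses (laY : la \in calY r n) (muY : mu \in calY r n).
Hypotheses (GT1 : GT_basis rho1 la v1) (GT2 : GT_basis rho2 mu v2).

(* A nonzero homomorphism [V^la -> delta_0^e \otimes V^mu] preserves
   Jucys-Murphy eigenvalues and shifts the components of weights by [e]. *)
Lemma twisted_hom_shape e (phi : 'M_(d1, d2)) :
  (forall g, rho1 g *m phi = delta0 g ^+ e *: (phi *m rho2 g)) ->
  phi != 0 -> la = iter e (@sh r _) mu.
Proof.
move=> phiP phi0.
have [T TT wn0] : exists2 T, T \in Tab la & v1 T *m phi != 0.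
  apply/exists_inP; apply: contraNT phi0 => /exists_inPn all0.
  apply/eqP; apply: (tab_span (GT_full GT1)) => T /all0.
  by rewrite negbK mulmx0 => /eqP.
have /submxP[u wE] : (v1 T *m phi <= tab_mx mu v2)%MS by apply/submx_full/(GT_full GT2).
have [k uk] : exists k, u 0 k != 0.
  apply/existsP; apply: contraNT wn0 => /existsPn u0.
  rewrite wE (_ : u = 0) ?mul0mx //; apply/rowP => k; rewrite mxE.
  by have := u0 k; rewrite negbK => /eqP.
(* Any tableau in the support of the image of [v1 T] will do: all of them share the weight of that
   image. *)
set S := enum_val k; have SS : S \in Tab mu by apply: enum_valP.
have z0 := prim_root_neq0 prz.
suff TS : T = iter e (@sh r _) S.
  by apply: Tab_shape TT _; rewrite TS; apply: Tab_iter_sh.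
apply: (Tab_weight_inj laY (calY_iter_sh e muY) TT (Tab_iter_sh e SS)).
move=> l c c' b b' Tl S'l.
have [c2 [b2 Sl]] := Tab_ex l SS.
have S'l2 : iter e (@sh r _) S (iter e (@ordS r) c2) b2 = Some l by rewrite iter_shE.
have [c'E b'E] := Tab_unique (Tab_iter_sh e SS) S'l S'l2; subst c' b'; split.
  apply: val_inj; rewrite /= iter_ordS.
  have c2n S' : S' \in Tab mu -> v2 S' *m rho2 (zetag prz l) =
      (\prod_(k < n) \prod_(c < r | lies_in k (S' c)) zetag prz l k k ^+ c) *: v2 S'.
    move=> S'S; apply: (GT_diag GT2) => //.
    by apply/is_diag_mxP => i j ij; rewrite (zetagE prz) ifN.
  (* As [delta0 (zetag l) = z], the eigenvalue [z ^+ c] on [v1 T] becomes [z ^+ c / z ^+ e] on its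
     image, so [c] is [c2 + e] modulo [r]. *)
  have := tab_eigen (x := z ^+ c / z ^+ e) (GT_free GT2) c2n _ uk; rewrite -wE -/S => wS.
  have : z ^+ c2 = z ^+ c / z ^+ e.
    rewrite -wS.
      have := GT_zetag GT2 SS Sl; rewrite c2n // => /eqP; rewrite -subr_eq0 -scalerBl.
      rewrite scaler_eq0 subr_eq0 => /orP[/eqP//|/eqP v0].
      by have := tab_neq0 (GT_free GT2) SS; rewrite v0 eqxx.
    rewrite -[in LHS]mulmxA; have := phiP (zetag prz l).
    rewrite delta0_zetag => /(canLR (scalerK _)).
    move=> <-; last by rewrite expf_neq0.
    rewrite -scalemxAr mulmxA (GT_zetag GT1 TT Tl) -scalemxAl scalerA mulrC //.
  move/(congr1 ( *%R (z ^+ e))); rewrite mulrCA mulfV ?expf_neq0 // mulr1 -exprD.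
  move/eqP; rewrite (eq_prim_root_expr prz) addnC => /eqP->.
  by rewrite modn_small.
have JMn S' : S' \in Tab mu -> v2 S' *m JM rho2 l = 
    (if [pick cb | S' cb.1 cb.2 == Some l] is Some (c, b)
     then r%:R * (b.2%:R - b.1%:R) else 0) *: v2 S'.
  move=> S'S; case: pickP => [[c3 [i j]] /= /eqP|no]; first exact: (GT_JM GT2).
  by have [c3 [b3 e3]] := Tab_ex l S'S; have := no (c3, b3); rewrite /= e3 eqxx.
have := tab_eigen (x := r%:R * (b.2%:R - b.1%:R)) (GT_free GT2) JMn _ uk; rewrite -wE -/S.
case: pickP => [[c3 [i j]] /= /eqP Sl3|no]; last by have := no (c2, b2); rewrite Sl eqxx.
have [? ?] := Tab_unique SS Sl Sl3; subst c2 b2 => /=.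
case: b Tl => b1 b2 Tl /=.
rewrite -mulmxA -(twisted_JM _ phiP) mulmxA (GT_JM GT1 TT Tl) -scalemxAl => /(_ erefl).
have r0 : r%:R != 0 :> F by rewrite pnatr_eq0 -lt0n (prim_order_gt0 prz).
move/(mulfI r0)/eqP; rewrite subr_eq addrAC eq_sym subr_eq -!natrD eqr_nat => /eqP.
by rewrite addnC => <-; rewrite addnC.
Qed.

End Weights.

(** * Eigenspaces of the associator *)

Lemma sum_unity_root (F : fieldType) (x : F) u :
  x ^+ u = 1 -> \sum_(i < u) x ^+ i = if x == 1 then u%:R else 0.
Proof.
move=> xu; case: eqP => [->|/eqP x1].
  by under eq_bigr do rewrite expr1n; rewrite sumr_const card_ord.
apply: (mulfI (x := x - 1)); first by rewrite subr_eq0.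
by rewrite -subrX1 xu subrr mulr0.
Qed.

Lemma iter_order_dvd (T : finType) (f : T -> T) x i : injective f ->
  iter i f x = x -> (fingraph.order f x %| i)%N.
Proof.
move=> f_inj; have ox := fingraph.iter_order f_inj x.
rewrite {1}(divn_eq i (fingraph.order f x)) addnC iterD -iter_iter.
rewrite (_ : iter _ (iter _ f) x = x); last by elim: (i %/ _)%N => //= k ->.
move=> ix; rewrite /dvdn -(@fingraph.findex_iter _ f x (i %% _)%N).
  by rewrite ix fingraph.findex0.
by rewrite ltn_mod fingraph.order_gt0.
Qed.

Lemma mxrank_sum_le (F : fieldType) d u (U : 'I_u -> 'M[F]_d) :
  (\rank (\sum_i U i)%MS <= \sum_i \rank (U i))%N.
Proof.
elim/big_ind2: _ => [|X1 k1 X2 k2 le1 le2|//]; first by rewrite mxrank0.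
by apply: leq_trans (leq_add le1 le2); apply: mxrank_adds_leqif.
Qed.

(** Rank count: [d], the rank of the sum of the [U i], is at most the sum of their ranks, hence at
    most that of the [E i], which by directness is at most [d]. Equality holds throughout. *)
Lemma full_sum_sub_direct (F : fieldType) d u (U E : 'I_u -> 'M[F]_d) :
  (forall i, (U i <= E i)%MS) -> mxdirect (\sum_i E i) ->
  row_full (\sum_i U i)%MS ->
  (forall i, (U i :=: E i)%MS) /\ mxdirect (\sum_i U i).
Proof.
move=> UE dE fU.
have leUE i : true -> (\rank (U i) <= \rank (E i) ?= iff (\rank (U i) == \rank (E i)))%N.
  by move=> _; split=> //; apply: mxrankS.
have rE : (\sum_i \rank (E i) <= d)%N.
  by move/mxdirectP: dE => /= <-; apply: rank_leq_col.
have dle : (\sum_i \rank (E i) <= \sum_i \rank (U i))%N.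
  by apply: leq_trans rE _; rewrite -[leqLHS](eqP fU) mxrank_sum_le.
have [le eqs] := leqif_sum leUE.
have Ueq : (\sum_i \rank (U i) == \sum_i \rank (E i))%N by rewrite eqn_leq le.
split.
  move: Ueq; rewrite eqs => /forallP Ueq i; apply/eqmxP; rewrite UE /=.
  by rewrite -(mxrank_leqif_sup (UE i)) (implyP (Ueq i)).
apply/mxdirectP => /=; apply/eqP; rewrite eqn_leq mxrank_sum_le /=.
by rewrite (eqP Ueq) (leq_trans rE) // (eqP fU).
Qed.

Section Period.

Variables r n p : nat.
Hypotheses (hr : (0 < r)%N) (hpr : (p %| r)%N).
Variable la : multidiag r n.
Local Notation m := (r %/ p)%N.
Local Notation mb := (m * bnum p la)%N.
Local Notation u := (unum p la).

Lemma bnum_dvd i : iter (m * i) (@sh r _) la = la -> (bnum p la %| i)%N.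
Proof.
move=> li; apply: iter_order_dvd; first exact: iter_sh_inj.
by rewrite iter_iter mulnC.
Qed.

Lemma iter_mb_sh t : iter (t * mb) (@sh r _) la = la.
Proof.
rewrite -iter_iter; elim: t => //= t ->; rewrite mulnC -iter_iter.
exact/fingraph.iter_order/iter_sh_inj.
Qed.

(** Both divisions are exact: [bnum] divides [p] because [m * p = r] shifts act trivially. *)
Lemma unum_mul : (u * mb)%N = r.
Proof.
rewrite mulnCA /unum [X in (_ * X)%N]divnK ?divnK //.
by apply: bnum_dvd; rewrite divnK // iter_sh_dvd.
Qed.

Lemma mb_gt0 : (0 < mb)%N.
Proof.
rewrite lt0n; apply/eqP => mb0; have := unum_mul; rewrite mb0 muln0 => r0.
by have := hr; rewrite -[X in (_ < X)%N]r0.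
Qed.

Lemma unum_gt0 : (0 < u)%N.
Proof.
rewrite lt0n; apply/eqP => u0; have := unum_mul; rewrite u0 mul0n => r0.
by have := hr; rewrite -[X in (_ < X)%N]r0.
Qed.

Lemma Tab_iter_mb t (T : tableau r n) :
  T \in Tab la -> iter (t * mb) (@sh r _) T \in Tab la.
Proof. by move=> /(Tab_iter_sh (t * mb)); rewrite iter_mb_sh. Qed.

Lemma iter_shV_sh k A (a : {ffun 'I_r -> A}) :
  iter k (@shV r A) a = iter (r.-1 * k) (@sh r A) a.
Proof.
apply: (can_inj (iter_shK k)); rewrite iter_shVK -iterD -mulSn prednK //.
by rewrite iter_sh_dvd // dvdn_mulr.
Qed.

Lemma Tab_iter_mbV t (T : tableau r n) :
  T \in Tab la -> iter (t * mb) (@shV r _) T \in Tab la.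
Proof. by rewrite iter_shV_sh mulnA; apply: Tab_iter_mb. Qed.

Hypothesis hn : (0 < n)%N.

(* If the largest label lies in component [q * mb + c] with [c < mb], shifting by
   [(u - 1 - q) * mb] moves it to the last [mb] components. *)
Lemma Tab_last_shift (T : tableau r n) : T \in Tab la ->
  exists2 T0, T0 \in Tab_last la mb &
    exists2 s, (s < u)%N & T = iter (s * mb) (@sh r _) T0.
Proof.
move=> TT; have nn : (n.-1 < n)%N by rewrite prednK.
have [c [b Tb]] := Tab_ex (Ordinal nn) TT.
(* [s] counts the blocks back from the last one to block [q], cyclically; the reduction modulo [u]
   gives 0 when [q] is already the last block. *)
pose q := (c %/ mb)%N; pose s := (q.+1 %% u)%N.
have rmb : (mb <= r)%N by rewrite -[leqRHS]unum_mul leq_pmull // unum_gt0.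
have c1 : (c %% mb + (r - mb) < r)%N.
  by rewrite addnC -ltn_subRL subKn ?ltn_mod ?mb_gt0.
pose c0 := Ordinal c1.
have c0E : iter (s * mb) (@ordS r) c0 = c.
  apply: val_inj; rewrite /= iter_ordS -modnDmr muln_modl unum_mul modn_mod modnDmr /= mulSn.
  rewrite addnA -[(_ + _ + mb)%N]addnA subnK // addnAC modnDr addnC -divn_eq modn_small //.
pose T0 := iter (s * mb) (@shV r _) T.
exists T0; last by exists s; rewrite ?ltn_mod ?unum_gt0 // iter_shVK.
rewrite inE Tab_iter_mbV //=; apply/existsP; exists (Ordinal nn).
apply/existsP; exists (rev_ord c0); rewrite /= prednK // eqxx /= rev_ordK.
apply/andP; split; first by lia.
apply/codomP; exists b; by rewrite iter_shVE c0E Tb.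
Qed.

(** The shifts by multiples of [mb] fix the shape but no tableau: they move the unique component
    containing the largest label. *)
Lemma Tab_shift_free t (T : tableau r n) : T \in Tab la -> (t < u)%N ->
  iter (t * mb) (@sh r _) T = T -> t = 0%N.
Proof.
move=> TT tu E; have nn : (n.-1 < n)%N by rewrite prednK.
have [c [b Tb]] := Tab_ex (Ordinal nn) TT.
have := iter_shE (t * mb) T c; rewrite E => Tc.
have [] := Tab_unique TT Tb (_ : T (iter (t * mb) (@ordS r) c) b = _); first by rewrite Tc.
move/(congr1 val); rewrite /= iter_ordS => /eqP.
rewrite -{1}(modn_small (ltn_ord c)) -{1}[nat_of_ord c]addn0 eqn_modDl mod0n.
rewrite modn_small => [|]; last by rewrite -[ltnRHS]unum_mul ltn_pmul2r // mb_gt0.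
by rewrite eq_sym muln_eq0 => /orP[/eqP//|]; rewrite gtn_eqF // mb_gt0.
Qed.

End Period.

Section Associator.

Variables (F : numClosedFieldType) (r n p : nat) (z : F).
Hypothesis prz : r.-primitive_root z.
Hypotheses (hpr : (p %| r)%N) (hn : (0 < n)%N).
Local Notation gT := (Gr1n prz n).
Variables (la : multidiag r n) (d : nat) (rho : mx_representation F [set: gT] d).
Variable v : tableau r n -> 'rV[F]_d.
Hypothesis GT : GT_basis rho la v.
Local Notation m := (r %/ p)%N.
Local Notation mb := (m * bnum p la)%N.
Local Notation u := (unum p la).
Local Notation A := (associator la v p).
Local Notation Vl l := (Vdelta z la v p l).
Local Notation hr := (prim_order_gt0 prz).

Lemma associatorX k T : T \in Tab la ->
  v T *m A ^+ k = v (iter (k * mb) (@shV r _) T).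
Proof.
move=> TT; elim: k => [|k IHk]; first by rewrite expr0 mulmx1.
rewrite exprSr -mulmxE mulmxA IHk associatorE ?(GT_free GT) //.
  by rewrite /shV_mb -iterD mulSn.
exact: (Tab_iter_mbV p hr k TT).
Qed.

Lemma associator_unum : A ^+ u = 1%:M.
Proof.
apply: (tab_span (GT_full GT)) => T TT; rewrite associatorX // unum_mul //.
by rewrite mulmx1 iter_shV_sh ?hr // iter_sh_dvd // dvdn_mull.
Qed.

Lemma zmb_prim : u.-primitive_root (z ^+ mb).
Proof.
have um := unum_mul hpr la.
have mbE : mb = (r %/ u)%N by rewrite -[LHS](mulKn mb (unum_gt0 hr hpr la)) um.
have ur : (u %| r)%N by apply/dvdnP; exists mb; rewrite mulnC um.
by rewrite mbE; apply: dvdn_prim_root.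
Qed.

Lemma zmb_inj (l l' : nat) : (l < u)%N -> (l' < u)%N ->
  z ^+ (l * mb) = z ^+ (l' * mb) -> l = l'.
Proof.
move=> lu l'u; rewrite (mulnC l) (mulnC l') (exprM z mb l) (exprM z mb l') => /eqP.
by rewrite (eq_prim_root_expr zmb_prim) !modn_small // => /eqP.
Qed.

(** The associator carries the summand of index [t.+1] to [z ^+ (l * mb)] times that of index [t],
    and the summands are periodic of period [u]. *)
Lemma vdelta_eigen l T : T \in Tab la ->
  vdelta z la v p l T *m A = z ^+ (l * mb) *: vdelta z la v p l T.
Proof.
move=> TT.
pose f t := z ^+ (t * (l * mb)) *: v (iter (t * mb) (@sh r _) T).
have fS t : f t.+1 *m A = z ^+ (l * mb) *: f t.
  rewrite -scalemxAl associatorE ?(GT_free GT) ?Tab_iter_mb // scalerA -exprD.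
  by rewrite mulSn /shV_mb [(t.+1 * mb)%N]mulSn iterD iter_shK.
have f0 : f u = f 0%N.
  rewrite /f mulnCA unum_mul // !mul0n expr0 iter_sh_dvd //.
  by rewrite mulnC exprM (prim_expr_order prz) expr1n.
have fE N : f N = f 0%N -> \sum_(t < N) f t = \sum_(t < N) f t.+1.
  case: N => [|N] fN; first by rewrite !big_ord0.
  by rewrite big_ord_recl big_ord_recr /= addrC fN.
rewrite (fE _ f0 : vdelta z la v p l T = _) mulmx_suml.
rewrite -(fE _ f0 : vdelta z la v p l T = _) scaler_sumr.
by apply: eq_bigr => t _; rewrite fS.
Qed.

Lemma Vdelta_sub_eigenspace l : (Vl l <= eigenspace A (z ^+ (l * mb)))%MS.
Proof.
rewrite genmxE; apply/row_subP => k; rewrite rowK; apply/eigenspaceP.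
by apply: vdelta_eigen; have := enum_valP k; rewrite inE => /andP[].
Qed.

Lemma vdelta_in_Vdelta l T : T \in Tab_last la mb -> (vdelta z la v p l T <= Vl l)%MS.
Proof.
move=> TT; rewrite genmxE -[T](enum_rankK_in TT) //.
by rewrite -(rowK (fun k => vdelta z la v p l (enum_val k))) row_sub.
Qed.

(* Fourier inversion over the cyclic group of order [u]. *)
Lemma sum_Vdelta_full : row_full (\sum_(l < u) Vl l)%MS.
Proof.
rewrite -sub1mx; apply: submx_trans (_ : (tab_mx la v <= _)%MS).
  by rewrite sub1mx (GT_full GT).
apply/row_subP => k; rewrite rowK; move: (enum_val k) (enum_valP k) => T TT.
have [T0 T0l [s su ->]] := Tab_last_shift hr hpr hn TT.
have um := unum_mul hpr la.
have T0T : T0 \in Tab la by move: T0l; rewrite inE => /andP[].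
have w0 : z ^+ mb != 0 by rewrite expf_neq0 // (prim_root_neq0 prz).
have u0 : u%:R != 0 :> F by rewrite pnatr_eq0 -lt0n unum_gt0 ?hr.
suff -> : v (iter (s * mb) (@sh r _) T0) =
    \sum_(l < u) (u%:R^-1 * ((z ^+ mb) ^+ s)^-1 ^+ l) *: vdelta z la v p l T0.
  apply: summx_sub => l _; apply: scalemx_sub.
  by apply: (sumsmx_sup l) => //; apply: vdelta_in_Vdelta.
under eq_bigr do rewrite scaler_sumr.
rewrite exchange_big /=.
have coef (t : 'I_u) :
    \sum_(l < u) (u%:R^-1 * ((z ^+ mb) ^+ s)^-1 ^+ l) * z ^+ (t * (l * mb))
    = (t == Ordinal su)%:R.
  transitivity (u%:R^-1 * \sum_(l < u) ((z ^+ mb) ^+ t / (z ^+ mb) ^+ s) ^+ l).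
    rewrite mulr_sumr; apply: eq_bigr => l _; rewrite -mulrA [_ ^+ l * _]mulrC exprMn.
    by congr (_ * (_ * _)); rewrite -(exprM _ t) -(exprM z) mulnA mulnC mulnA.
  rewrite sum_unity_root; last first.
    rewrite exprMn exprVn (exprAC _ t u) (exprAC _ s u).
    by rewrite (prim_expr_order zmb_prim) !expr1n invr1 mulr1.
  have -> : ((z ^+ mb) ^+ t / (z ^+ mb) ^+ s == 1) = (t == Ordinal su).
    have ws0 := expf_neq0 s w0; rewrite -(inj_eq (mulIf ws0)) /= divfK // mul1r.
    by rewrite (eq_prim_root_expr zmb_prim) !modn_small.
  by case: eqP; rewrite ?mulVf ?mulr0.
rewrite (bigD1 (Ordinal su)) //= [X in _ + X]big1 => [|t ts].
  under eq_bigr do rewrite scalerA.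
  by rewrite -scaler_suml (coef (Ordinal su)) eqxx scale1r addr0.
by under eq_bigr do rewrite scalerA; rewrite -scaler_suml coef (negPf ts) scale0r.
Qed.

Lemma Tab_ex0 : exists T, T \in Tab la.
Proof.
have [[_ d0 _] fu] := (GT_irr GT, GT_full GT); apply/set0Pn; apply: contraNneq d0 => T0.
by rewrite -mxrank_eq0 mxrank1 -(eqP fu) -leqn0 (leq_trans (rank_leq_row _)) // T0 cards0.
Qed.

Lemma Vdelta_neq0 l : Vl l != 0.
Proof.
have [T1 T1T] := Tab_ex0; have [T Tl _] := Tab_last_shift hr hpr hn T1T.
have TT : T \in Tab la by move: Tl; rewrite inE => /andP[].
apply: contraTneq (vdelta_in_Vdelta l Tl) => ->; rewrite submx0; apply/eqP.
(* [a S] collects the coefficient of [v S]. Since the shifts act freely, only [t = 0] contributes to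
   [a T], which is thus 1. *)
pose a S := \sum_(t < u | iter (t * mb) (@sh r _) T == S) z ^+ (t * (l * mb)).
have E : vdelta z la v p l T = \sum_(S in Tab la) a S *: v S.
  rewrite /vdelta (partition_big (fun t : 'I_u => iter (t * mb) (@sh r _) T) (mem (Tab la))) /=.
    apply: eq_bigr => S _; rewrite scaler_suml.
    by apply: eq_bigr => t /eqP->.
  by move=> t _; apply: Tab_iter_mb.
rewrite E => /(tab_free (GT_free GT))/(_ T TT)/eqP; apply/negP.
rewrite /a (big_pred1 (Ordinal (unum_gt0 hr hpr la))) ?mul0n ?expr0 ?oner_eq0 // => t.
apply/eqP/eqP => [e|->] //; apply: val_inj => /=.
exact: (Tab_shift_free hr hpr hn TT (ltn_ord t) e).
Qed.

Lemma Vdelta_eigenspaces :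
  (forall l : 'I_u, (Vl l :=: eigenspace A (z ^+ (l * mb)))%MS) /\
  mxdirect (\sum_(l < u) Vl l).
Proof.
apply: full_sum_sub_direct sum_Vdelta_full => [l|]; first exact: Vdelta_sub_eigenspace.
apply: mxdirect_sum_eigenspace => l l' _ _ /(zmb_inj (ltn_ord l) (ltn_ord l')).
exact: val_inj.
Qed.

Lemma associator_eigenvalue a :
  eigenvalue A a <-> exists l : 'I_u, a = z ^+ (l * mb).
Proof.
split=> [/eigenvalueP[w wA w0]|[l ->]].
  have wAk k : w *m A ^+ k = a ^+ k *: w.
    elim: k => [|k IHk]; first by rewrite !expr0 mulmx1 scale1r.
    by rewrite exprSr -mulmxE mulmxA IHk -scalemxAl wA scalerA -exprSr.
  have := wAk u; rewrite associator_unum mulmx1 => /eqP; rewrite -subr_eq0.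
  rewrite -[X in X - _]scale1r -scalerBl scaler_eq0 (negPf w0) orbF subr_eq0 => /eqP/esym.
  by move=> /(prim_rootP zmb_prim)[l ->]; exists l; rewrite (mulnC l) (exprM z mb).
rewrite /eigenvalue; apply: contraNneq (Vdelta_neq0 l) => e0.
by rewrite -submx0 -e0 Vdelta_sub_eigenspace.
Qed.

End Associator.

(** * Homomorphisms of G(r,p,n)-modules *)

Section TwistedParts.

Variables (F : numClosedFieldType) (r n p : nat) (z : F).
Hypothesis prz : r.-primitive_root z.
Hypotheses (hp : (0 < p)%N) (hpr : (p %| r)%N) (hn : (0 < n)%N).
Local Notation gT := (Gr1n prz n).
Local Notation H := (Grpn prz n p).
Local Notation m := (r %/ p)%N.
Variables (d1 d2 : nat) (rho1 : mx_representation F [set: gT] d1).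
Variable rho2 : mx_representation F [set: gT] d2.
Variable phi : 'M[F]_(d1, d2).
Hypothesis phiH : forall h, h \in H -> rho1 h *m phi = phi *m rho2 h.

Let g0 : gT := zetag prz (Ordinal hn).
Let conj k := rho1 (g0 ^+ k)%g *m phi *m rho2 (g0 ^- k)%g.

(* The isotypic components of [phi] under the action of [G(r,1,n)/G(r,p,n)],
   a cyclic group generated by the class of [zeta_1]. *)
Definition twisted_part (i : nat) : 'M[F]_(d1, d2) :=
  \sum_(k < p) (z ^+ (m * i) ^+ k)^-1 *: conj k.

Lemma zm_prim : p.-primitive_root (z ^+ m).
Proof. exact: dvdn_prim_root. Qed.

Lemma Grpn_delta0 (h : gT) : (h \in H) = (delta0 h ^+ m == 1).
Proof. by rewrite inE. Qed.

Lemma Grpn_conj (g h : gT) : h \in H -> (h ^ g)%g \in H.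
Proof.
rewrite !Grpn_delta0 !delta0M delta0V // mulrCA mulVf ?mulr1 //.
exact: delta0_neq0.
Qed.

Lemma repr_M (d : nat) (rho : mx_representation F [set: gT] d) (g h : gT) :
  rho (g * h)%g = rho g *m rho h.
Proof. by rewrite repr_mxM ?inE. Qed.

Lemma conj_H k h : h \in H -> rho1 h *m conj k = conj k *m rho2 h.
Proof.
move=> hH; rewrite /conj !mulmxA -repr_M conjgC repr_M -(mulmxA _ _ phi).
rewrite (phiH (Grpn_conj _ hH)) -!mulmxA -!repr_M conjgE; do 2!congr (_ *m _).
by congr (rho2 _); rewrite !mulgA mulgK.
Qed.

Lemma conjS k : rho1 g0 *m conj k = conj k.+1 *m rho2 g0.
Proof.
rewrite /conj !mulmxA -repr_M -expgS -[in RHS]mulmxA -repr_M.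
by congr (_ *m rho2 _); rewrite expgS invMg mulgKV.
Qed.

Lemma conj_p : conj p = conj 0.
Proof.
have g0p : (g0 ^+ p)%g \in H.
  rewrite Grpn_delta0 delta0X // delta0_zetag -exprM mulnC divnK //.
  by rewrite (prim_expr_order prz).
by rewrite /conj (phiH g0p) -[in LHS]mulmxA -repr_M mulgV expg0 invg1 !repr_mx1 mul1mx !mulmx1.
Qed.

(** Orthogonality of the characters of a cyclic group of order [p]: summing over [i] leaves only
    [conj 0 = phi]. *)
Lemma sum_twisted_part : \sum_(i < p) twisted_part i = p%:R *: phi.
Proof.
rewrite exchange_big /= (bigD1 (Ordinal hp)) //= [X in _ + X]big1 => [|k k0].
  rewrite addr0 {1}/conj expg0 invg1 !repr_mx1 mul1mx mulmx1.
  by under eq_bigr do rewrite expr0 invr1 scale1r; rewrite sumr_const card_ord scaler_nat.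
rewrite -scaler_suml.
have -> : \sum_(i < p) (z ^+ (m * i) ^+ k)^-1 = \sum_(i < p) ((z ^+ m) ^- k) ^+ i.
  by apply: eq_bigr => i _; rewrite exprVn -!exprM mulnAC.
rewrite sum_unity_root.
  rewrite invr_eq1 -(prim_order_dvd zm_prim) ifN ?scale0r //.
  by rewrite gtnNdvd // lt0n.
by rewrite exprVn (exprAC _ k p) (prim_expr_order zm_prim) expr1n invr1.
Qed.

(** The action of [g0] shifts the summation index, which is harmless as [conj] is [p]-periodic
    ([g0 ^+ p] lies in [H]), and produces the factor [z ^+ (m * i)]. Elements of [H] commute with
    every summand, and each [g] is an element of [H] times a power of [g0]. *)
Lemma twisted_partP i (g : gT) :
  rho1 g *m twisted_part i = delta0 g ^+ (m * i) *: (twisted_part i *m rho2 g).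
Proof.
have z0 := prim_root_neq0 prz.
have g0P : rho1 g0 *m twisted_part i = z ^+ (m * i) *: (twisted_part i *m rho2 g0).
  rewrite /twisted_part; pose w := z ^+ (m * i); rewrite -/w.
  have w0 : w != 0 by rewrite expf_neq0.
  pose f k := (w ^+ k)^-1 *: conj k.
  have fE N : f N = f 0%N -> \sum_(t < N) f t = \sum_(t < N) f t.+1.
    case: N => [|N] fN; first by rewrite !big_ord0.
    by rewrite big_ord_recl big_ord_recr /= addrC fN.
  have fp : f p = f 0%N.
    rewrite /f conj_p expr0 -exprM mulnAC divnK //.
    by rewrite exprM (prim_expr_order prz) expr1n.
  rewrite -/(f _) [X in _ = _ *: (X *m _)](fE p fp) mulmx_sumr mulmx_suml scaler_sumr.
  apply: eq_bigr => k _; rewrite -scalemxAr conjS -scalemxAl scalerA exprS invfM.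
  by rewrite mulrA mulfV // mul1r.
have g0kP k : rho1 (g0 ^+ k)%g *m twisted_part i =
    z ^+ (m * i) ^+ k *: (twisted_part i *m rho2 (g0 ^+ k)%g).
  elim: k => [|k IHk]; first by rewrite expg0 !repr_mx1 mul1mx mulmx1 scale1r.
  rewrite expgS repr_M -mulmxA IHk -scalemxAr mulmxA g0P -scalemxAl scalerA -exprSr.
  by rewrite repr_M !mulmxA.
have [k gk] := delta0_zeta g.
have hH : (g * g0 ^- k)%g \in H.
  rewrite Grpn_delta0 delta0M delta0V // delta0X // delta0_zetag gk.
  by rewrite mulfV ?expr1n // expf_neq0.
have hP h : h \in H -> rho1 h *m twisted_part i = twisted_part i *m rho2 h.
  move=> hH'; rewrite mulmx_sumr mulmx_suml; apply: eq_bigr => j _.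
  by rewrite -scalemxAr conj_H // scalemxAl.
rewrite -{1}(mulgKV (g0 ^+ k)%g g) repr_M -mulmxA g0kP -scalemxAr mulmxA hP //.
by rewrite -mulmxA -repr_M mulgKV gk -!exprM (mulnC k).
Qed.

End TwistedParts.

Lemma pchar_num_group (F : numClosedFieldType) (gT : finGroupType) (G : {group gT}) :
  ([pchar F]%R^'.-group G)%g.
Proof. by apply/pgroupP => q _; rewrite inE /= pchar_num. Qed.

Lemma module_projection (F : numClosedFieldType) (gT : finGroupType) (G : {group gT})
    d (rG : mx_representation F G d) (U : 'M_d) : mxmodule rG U ->
  exists2 P : 'M_d, forall x, x \in G -> rG x *m P = P *m rG x &
    (P <= U)%MS /\ U *m P = U.
Proof.
move=> modU.
have [W modW defU /mxdirect_addsP UW] :=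
  mx_Maschke_pchar rG (pchar_num_group F G) modU (submx1 U).
exists (proj_mx U W); last by rewrite -[X in (X <= _)%MS]mul1mx proj_mx_sub proj_mx_id.
have := proj_mx_hom UW modU modW; rewrite defU => /hom_mxP hP x xG.
by have := hP x xG; rewrite !mul1mx.
Qed.

Section Simple.

Variables (F : numClosedFieldType) (r n p : nat) (z : F).
Hypothesis prz : r.-primitive_root z.
Hypotheses (hp : (0 < p)%N) (hpr : (p %| r)%N) (hn : (0 < n)%N).
Local Notation gT := (Gr1n prz n).
Local Notation H := (Grpn prz n p).
Variables (la : multidiag r n) (d : nat) (rho : mx_representation F [set: gT] d).
Variable v : tableau r n -> 'rV[F]_d.
Hypothesis laY : la \in calY r n.
Hypothesis GT : GT_basis rho la v.
Hypothesis norm : normalized rho la v p.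
Local Notation m := (r %/ p)%N.
Local Notation mb := (m * bnum p la)%N.
Local Notation u := (unum p la).
Local Notation A := (associator la v p).
Local Notation Vl l := (Vdelta z la v p l).
Local Notation hr := (prim_order_gt0 prz).

Lemma associatorX_twist k (g : gT) :
  rho g *m A ^+ k = delta0 g ^+ (mb * k) *: (A ^+ k *m rho g).
Proof.
elim: k => [|k IHk]; first by rewrite muln0 !expr0 mulmx1 mul1mx scale1r.
rewrite exprS -mulmxE mulmxA norm -scalemxAr -scalemxAl -(mulmxA A (rho g)) IHk -scalemxAr.
by rewrite scalerA mulmxA -exprD mulnS.
Qed.

(* The twisted parts of an endomorphism commuting with [G(r,p,n)] are, by
   Schur's lemma, multiples of powers of the associator. *)
Lemma Grpn_endo_scalar (phi : 'M_d) a :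
  (forall h, h \in H -> rho h *m phi = phi *m rho h) ->
  exists x, forall k (W : 'M_(k, d)), W *m A = a *: W -> W *m phi = x *: W.
Proof.
move=> phiH; set f := twisted_part p hn rho rho phi.
have fP i : exists x, forall k (W : 'M_(k, d)), W *m A = a *: W -> W *m f i = x *: W.
  have [->|fi0] := eqVneq (f i) 0.
    by exists 0 => k W _; rewrite mulmx0 scale0r.
  have fT := twisted_partP hpr hn phiH i; rewrite -/f in fT.
  (* A nonzero part forces [la = sh^(m * i) la], so [i] is a multiple [j] of the period. *)
  have /esym/bnum_dvd := twisted_hom_shape laY laY GT GT fT fi0.
  move=> /dvdnP[j iE].
  (* [A ^+ (j * u.-1)] is the inverse of [A ^+ j]. The two twists add up to [delta0 ^+ (r * j) = 1],
     so the product is an honest endomorphism of the irreducible [rho], hence a scalar. *)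
  have MC : centgmx rho (A ^+ (j * u.-1) *m f i).
    apply/centgmxP => g _; apply/esym.
    rewrite mulmxA associatorX_twist -scalemxAl -mulmxA fT -scalemxAr scalerA mulmxA.
    have miE : (m * i = mb * j)%N by rewrite iE mulnA mulnAC.
    rewrite -exprD miE -mulnDr -mulnSr prednK ?(unum_gt0 hr hpr) //.
    rewrite mulnCA (mulnC mb) unum_mul //.
    by rewrite mulnC exprM delta0_unity expr1n scale1r.
  have abs_irr := group_closure_closed_field (GT_irr GT).
  have [c cE] := is_scalar_mxP (mx_abs_irr_cent_scalar abs_irr MC).
  have fE : f i = c *: A ^+ j.
    have : A ^+ j *m (A ^+ (j * u.-1) *m f i) = A ^+ j *m c%:M by rewrite cE.
    rewrite mulmxA mulmxE -exprD -mulnS prednK ?(unum_gt0 hr hpr) // mulnC exprM.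
    by rewrite (associator_unum hpr GT) -mulmxE expr1n mul1mx mul_mx_scalar.
  exists (c * a ^+ j); move=> k W WA; rewrite fE -scalemxAr -scalerA; congr (_ *: _).
  elim: j {iE MC cE fE} => [|j IHj]; first by rewrite !expr0 mulmx1 scale1r.
  by rewrite exprS -mulmxE mulmxA WA -scalemxAl IHj scalerA -exprS.
have [x xP] := fin_all_exists (fun i : 'I_p => fP i).
exists (p%:R^-1 * \sum_i x i); move=> k W WA.
have p0 : p%:R != 0 :> F by rewrite pnatr_eq0 -lt0n.
have -> : phi = p%:R^-1 *: \sum_(i < p) f i.
  by rewrite sum_twisted_part // scalerA mulVf // scale1r.
rewrite -scalemxAr -scalerA mulmx_sumr scaler_suml; congr (_ *: _).
by apply: eq_bigr => i _; apply: xP.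
Qed.

Lemma Vdelta_eigen (l : 'I_u) : Vl l *m A = z ^+ (l * mb) *: Vl l.
Proof. by apply/eigenspaceP; rewrite (Vdelta_eigenspaces hpr hn GT).1. Qed.

Lemma sub_Vdelta (l : 'I_u) k (W : 'M_(k, d)) :
  W *m A = z ^+ (l * mb) *: W -> (W <= Vl l)%MS.
Proof. by move=> /eigenspaceP; rewrite (Vdelta_eigenspaces hpr hn GT).1. Qed.

Lemma Vdelta_module (l : 'I_u) : mxmodule (res_Grpn rho p) (Vl l).
Proof.
apply/mxmoduleP => h hH; apply: sub_Vdelta; rewrite -mulmxA norm -scalemxAr exprM.
move: hH; rewrite Grpn_delta0 => /eqP->.
by rewrite expr1n scale1r mulmxA Vdelta_eigen -scalemxAl.
Qed.

(** A projection onto a submodule [U] commutes with [H], hence is a scalar on the whole eigenspace.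
    The scalar is 1 because it is 1 on [U], so the eigenspace lies in [U]. *)
Lemma Vdelta_simple (l : 'I_u) : mxsimple (res_Grpn rho p) (Vl l).
Proof.
split=> [||U modU sUV U0]; first exact: Vdelta_module.
  exact: (Vdelta_neq0 hpr hn GT).
have [P Phom [PU UP]] := module_projection modU.
have [x xP] := Grpn_endo_scalar (z ^+ (l * mb)) Phom.
have UA : U *m A = z ^+ (l * mb) *: U.
  by apply/eigenspaceP; rewrite -(Vdelta_eigenspaces hpr hn GT).1.
have x1 : x = 1.
  have /eqP := xP _ U UA; rewrite UP -subr_eq0 -[X in X - _]scale1r -scalerBl.
  by rewrite scaler_eq0 (negPf U0) orbF subr_eq0 => /eqP.
have := xP _ _ (Vdelta_eigen l); rewrite x1 scale1r => <-.
exact: mulmx_sub.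
Qed.

End Simple.

(** * Completeness *)

Lemma card_gr1n (F : numClosedFieldType) r n (z : F) (prz : r.-primitive_root z) :
  (#|[set: Gr1n prz n]| <= r ^ n * n`!)%N.
Proof.
have ex (g : Gr1n prz n) : exists a : {ffun 'I_n -> 'I_r} * 'S_n,
    forall i j, g i j = if j == a.2 i then z ^+ a.1 i else 0.
  have [s [s1 s2]] := gr1n_permP g.
  have /fin_all_exists[e eP] i : exists k : 'I_r, g i (s i) = z ^+ k.
    have /eqP/(prim_rootP prz)[k ->] : g i (s i) ^+ r == 1 by rewrite -(cycGE prz).
    by exists k.
  exists (finfun e, s) => i j /=; rewrite ffunE -eP.
  by case: eqVneq => [->|/s2].
have [f fP] := fin_all_exists ex.
have f_inj : injective f.
  by move=> g h gh; apply/val_inj/matrixP => i j; rewrite /= !fP gh.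
by rewrite cardsT (leq_trans (leq_card _ f_inj)) // card_prod card_ffun !card_ord card_Sn.
Qed.

(** [Phi] sends the basis element [x] of the group algebra of [G] to [w *m rK x] if [x] is in [K]
    and to 0 otherwise. Right multiplication by [K] preserves both cases, so no induced module is
    needed. *)
Lemma regular_to_irr (F : fieldType) (gT : finGroupType) (G K : {group gT})
    (sKG : K \subset G)
    d (rK : mx_representation F K d) : mx_irreducible rK ->
  exists2 Phi : 'M_(#|G|, d), Phi != 0 &
    forall h, h \in K -> regular_repr F G h *m Phi = Phi *m rK h.
Proof.
case/mx_irrP => d0 _; pose w : 'rV[F]_d := delta_mx 0 (Ordinal d0).
pose Phi := \matrix_(k < #|G|) (if enum_val k \in K then w *m rK (enum_val k) else 0).
have PhiE x : x \in G -> row (gring_index G x) Phi = if x \in K then w *m rK x else 0.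
  by move=> xG; rewrite rowK gring_indexK.
exists Phi.
  apply/eqP => Phi0; have := PhiE 1%g (group1 G).
  rewrite group1 repr_mx1 mulmx1 Phi0 row0 => /rowP/(_ (Ordinal d0)).
  by rewrite !mxE !eqxx => /esym/eqP; rewrite oner_eq0.
move=> h hK; have hG := subsetP sKG h hK.
apply/row_matrixP => k; rewrite !row_mul rowK -rowE.
have kG := enum_valP k.
rewrite (PhiE _ (groupM kG hG)) groupMr // rowK; case: ifP => kK; last by rewrite mul0mx.
by rewrite repr_mxM // mulmxA.
Qed.

Section Complete.

Variables (F : numClosedFieldType) (r p n : nat) (z : F).
Hypothesis prz : r.-primitive_root z.
Local Notation gT := (Gr1n prz n).
Local Notation H := (Grpn prz n p).
Local Notation m := (r %/ p)%N.
Variables (d : multidiag r n -> nat)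
    (rho : forall la : multidiag r n, mx_representation F [set: gT] (d la))
    (v : forall la : multidiag r n, tableau r n -> 'rV[F]_(d la)).
Hypothesis hGT : forall la, la \in calY r n -> GT_basis (rho la) la (v la).

Lemma GT_degree la : la \in calY r n -> d la = #|Tab la|.
Proof.
move=> laY; have := GT_free (hGT laY); have := GT_full (hGT laY).
by rewrite /row_free /row_full => /eqP-> /eqP.
Qed.

Lemma GT_rsim_inj la mu : la \in calY r n -> mu \in calY r n ->
  mx_rsim (rho la) (rho mu) -> la = mu.
Proof.
move=> laY muY [B eqd fB hB].
apply: (twisted_hom_shape (e := 0) laY muY (hGT laY) (hGT muY) (phi := B)).
  by move=> g; rewrite expr0 scale1r hB ?inE.
apply: contraTneq fB => ->; rewrite /row_free mxrank0 eq_sym.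
by have [_] := GT_irr (hGT laY); rewrite -mxrank_eq0 mxrank1.
Qed.

(* Pairwise non-isomorphic irreducibles whose squared degrees sum to the order
   of the group exhaust the irreducibles. *)
Lemma GT_complete d' (rho' : mx_representation F [set: gT] d') :
  mx_irreducible rho' -> exists2 la, la \in calY r n & mx_rsim (rho la) rho'.
Proof.
move=> irr'; pose sG : irrType F [set: gT] := DecSocleType _.
have F'G := pchar_num_group F [set: gT]%G.
pose f la := irr_comp sG (rho la).
have fP la : la \in calY r n -> mx_rsim (rho la) (irr_repr (f la)).
  by move=> laY; apply: rsim_irr_comp_pchar (GT_irr (hGT laY)).
have f_inj : {in calY r n &, injective f}.
  move=> la mu laY muY fE; apply: GT_rsim_inj => //.
  by apply: mx_rsim_trans (fP la laY) _; rewrite fE; apply/mx_rsim_sym/fP.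
have f_surj i : i \in [set f la | la in calY r n].
  apply/contraT => ni.
  have := sum_irr_degree_pchar sG F'G (@group_closure_closed_field F _ _).
  have le1 : (#|[set: gT]| <= \sum_(j in [set f la | la in calY r n]) irr_degree j ^ 2)%N.
    rewrite big_imset //= (leq_trans (card_gr1n _ _)) // (leq_trans (sum_Tab_sqr r n)) //.
    apply: leq_sum => la laY; rewrite -GT_degree //.
    by have [B eqd _ _] := fP _ laY; rewrite eqd.
  move=> sumE; have := le1; rewrite -sumE (bigID (mem [set f la | la in calY r n])) /=.
  rewrite -[leqRHS]addn0 leq_add2l leqn0 (bigD1 i) //= addn_eq0 expn_eq0.
  by rewrite gtn_eqF ?irr_degree_gt0.
have /imsetP[la laY fE] := f_surj (irr_comp sG rho').
exists la => //; apply: mx_rsim_trans (fP la laY) _; rewrite -fE.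
exact/mx_rsim_sym/rsim_irr_comp_pchar.
Qed.

Lemma twist_mx_repr e la : mx_repr [set: gT] (fun g => delta0 g ^+ e *: rho la g).
Proof.
split=> [|g h _ _]; first by rewrite delta0_1 expr1n scale1r repr_mx1.
by rewrite delta0M exprMn repr_M -scalemxAl -scalemxAr scalerA.
Qed.

Definition twist e la := MxRepresentation (twist_mx_repr e la).

Lemma twist_irr e la : la \in calY r n -> mx_irreducible (twist e la).
Proof.
move=> /hGT/GT_irr/mx_irrP[d0 irr]; apply/mx_irrP; split=> // U /mxmoduleP modU.
apply: irr; apply/mxmoduleP => g gG; have := modU g gG; rewrite /= -scalemxAr.
by rewrite eqmx_scale // expf_neq0 // delta0_neq0.
Qed.

(** Completeness supplies some [mu] for the irreducible twist; the isomorphism is itself a twisted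
    homomorphism, so weights determine [mu]. *)
Lemma twist_rsim e la : la \in calY r n ->
  mx_rsim (rho (iter e (@sh r _) la)) (twist e la).
Proof.
move=> laY; have [mu muY [B eqd fB hB]] := GT_complete (twist_irr e laY).
suff <- : mu = iter e (@sh r _) la by exists B.
apply: (twisted_hom_shape muY laY (hGT muY) (hGT laY) (phi := B)).
  by move=> g; rewrite hB ?inE // -scalemxAr.
apply: contraTneq fB => ->; rewrite /row_free mxrank0 eq_sym.
by have [_] := GT_irr (hGT muY); rewrite -mxrank_eq0 mxrank1.
Qed.

(** By Maschke the regular module of [G] is a sum of simple ones, so a nonzero [H]-map out of it
    survives on a simple submodule, which completeness identifies with some [V^la]. *)
Lemma Grpn_irr_hom d' (rho' : mx_representation F H d') : mx_irreducible rho' ->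
  exists2 la, la \in calY r n & exists2 psi : 'M_(d la, d'), psi != 0 &
    forall h, h \in H -> rho la h *m psi = psi *m rho' h.
Proof.
move=> irr'; have [Phi Phi0 hPhi] := regular_to_irr (subsetT H) irr'.
pose sG : irrType F [set: gT] := DecSocleType _.
have F'G := pchar_num_group F [set: gT]%G.
have soc1 : Socle sG = 1%:M by apply: reducible_Socle1; apply: mx_Maschke_pchar.
have [W WPhi] : exists W : sG, (W : 'M_#|[set: gT]|) *m Phi != 0.
  apply/existsP; apply: contraNT Phi0 => /existsPn W0; rewrite -[Phi]mul1mx -soc1.
  apply/eqP/sub_kermxP/sumsmx_subP => W _; apply/sub_kermxP/eqP.
  by have := W0 W; rewrite negbK.
have [I [M isoM defW]] := component_mx_def (socle_simple W).
have [i MPhi] : exists i, M i *m Phi != 0.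
  apply/existsP; apply: contraNT WPhi => /existsPn M0; rewrite /socle_val defW.
  apply/eqP/sub_kermxP/sumsmx_subP => i _; apply/sub_kermxP/eqP.
  by have := M0 i; rewrite negbK.
have simM := mx_iso_simple (isoM i) (socle_simple W).
have modM := mxsimple_module simM.
have irrM : mx_irreducible (submod_repr modM) by apply/submod_mx_irr.
have [la laY [B eqd fB hB]] := GT_complete irrM.
have [V V0 VJ] : exists2 V : 'M_(\rank (M i), _), V *m Phi != 0 &
    forall h, submod_mx modM h *m V = V *m regular_repr F [set: gT]%G h.
  exists (val_submod 1%:M) => [|h].
    by rewrite -mxrank_eq0 (eqmxMr _ (val_submod1 _)) mxrank_eq0.
  by rewrite -(val_submodJ modM) ?inE // mul1mx [RHS]val_submodE.
exists la => //; exists (B *m (V *m Phi)).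
  apply: contraNneq V0 => BV.
  have B_full : row_full B by rewrite /row_full (eqP fB) eqd.
  by apply/eqP/(row_full_inj B_full); rewrite BV mulmx0.
move=> h hH; have VPhi : submod_mx modM h *m (V *m Phi) = (V *m Phi) *m rho' h.
  by rewrite (mulmxA _ V) VJ -(mulmxA V Phi) -hPhi // (mulmxA V).
rewrite mulmxA hB ?inE //.
exact: etrans (esym (mulmxA _ _ _)) (etrans (congr1 (mulmx B) VPhi) (mulmxA _ _ _)).
Qed.

End Complete.

(** * Necklace classes as orbits of the shift by [m] *)

Section Necklaces.

Variables r p n : nat.
Hypotheses (hr : (0 < r)%N) (hp : (0 < p)%N) (hpr : (p %| r)%N).
Local Notation m := (r %/ p)%N.
Implicit Types la mu : multidiag r n.

(** Write a component as [q * m + i] with [i < m]: shifting by [t * m] keeps [i] and adds [t] to [q]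
    modulo [p], as [p * m = r]. *)
Lemma necklace_eqP la mu :
  reflect (exists t, mu = iter (t * m) (@sh r _) la) (necklace_eq p la mu).
Proof.
have pm : (p * m = r)%N by rewrite mulnC divnK.
have m0 : (0 < m)%N by rewrite divn_gt0 // dvdn_leq.
have cellP (i : 'I_m) (j : 'I_p) : (j * m + i < r)%N.
  rewrite -[ltnRHS]pm; apply: (@leq_trans (j.+1 * m)); last by rewrite leq_mul2r ltn_ord orbT.
  by rewrite mulSn addnC ltn_add2r.
have shift (c : 'I_r) t :
    iter (t * m) (@ordS r) c = (((c %/ m) + t) %% p * m + c %% m)%N :> nat.
  rewrite iter_ordS; set q := (c %/ m)%N; set x := (q + t)%N.
  have -> : (c + t * m = x %/ p * (p * m) + (x %% p * m + c %% m))%N.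
    by rewrite {1}(divn_eq c m) addnAC -mulnDl addnA mulnA -mulnDl -divn_eq.
  rewrite pm modnMDl modn_small //.
  exact: (cellP (Ordinal (ltn_pmod c m0)) (Ordinal (ltn_pmod x hp))).
have qp (c : 'I_r) : (c %/ m < p)%N by rewrite ltn_divLR // pm.
apply: (iffP existsP) => [[t tP]|[t ->]].
  exists t; rewrite -[LHS](iter_shVK (t * m)); congr (iter _ _ _).
  apply/ffunP => c; rewrite iter_shVE.
  pose j' := Ordinal (ltn_pmod (c %/ m + t) hp).
  have /forallP/(_ (Ordinal (qp c)))/forallP/(_ j')/implyP/(_ (eqxx _))/eqP :=
    forallP tP (Ordinal (ltn_pmod c m0)).
  by rewrite (@necklaceE _ _ _ la _ _ c) -?divn_eq // => ->; apply/esym/necklaceE; rewrite shift.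
exists (Ordinal (ltn_pmod t hp)).
apply/forallP => i; apply/forallP => j; apply/forallP => j'; apply/implyP => /eqP /= jj'.
pose c := Ordinal (cellP i j).
rewrite (@necklaceE _ _ _ la _ _ c) // (@necklaceE _ _ _ _ _ _ (iter (t * m) (@ordS r) c)).
  by rewrite iter_shE.
rewrite shift jj' modnDmr /= divnMDl // modnMDl.
by rewrite [(i %/ m)%N]divn_small ?addn0 ?[(i %% m)%N]modn_small.
Qed.

Lemma transversal_ex (R : {set multidiag r n}) la :
  is_transversal R (calYmp r n p) (calY r n) -> la \in calY r n ->
  exists2 mu, mu \in R & necklace_eq p la mu.
Proof.
move=> /and3P[_ _ /forall_inP Rt] laY.
have /Rt/cards1P[mu] : [set y in calY r n | necklace_eq p la y] \in calYmp r n p.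
  by apply: imset_f.
by move/setP/(_ mu); rewrite !inE eqxx => /and3P[muR _ lamu]; exists mu.
Qed.

Lemma transversal_eq (R : {set multidiag r n}) la mu :
  is_transversal R (calYmp r n p) (calY r n) -> la \in R -> mu \in R ->
  necklace_eq p la mu -> la = mu.
Proof.
move=> tR; have /subsetP RY := transversal_sub tR.
case/and3P: tR => _ _ /forall_inP Rt laR muR lamu.
have /Rt/cards1P[nu /setP E] : [set y in calY r n | necklace_eq p la y] \in calYmp r n p.
  by apply: imset_f; apply: RY.
have lala : necklace_eq p la la by apply/necklace_eqP; exists 0%N.
have := E la; have := E mu; rewrite !inE laR muR lamu lala.
by have := RY _ laR; have := RY _ muR; rewrite !inE => -> -> /esym/eqP-> /esym/eqP->.
Qed.

End Necklaces.

(** * Intertwiners and isomorphism types of simple submodules *)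

Section Homomorphisms.

Variables (F : numClosedFieldType) (gT : finGroupType) (G : {group gT}).

Lemma irr_hom_rsim d1 d2 (r1 : mx_representation F G d1) (r2 : mx_representation F G d2)
    (N : 'M_(d1, d2)) : mx_irreducible r1 -> mx_irreducible r2 -> N != 0 ->
  (forall x, x \in G -> r1 x *m N = N *m r2 x) -> mx_rsim r1 r2.
Proof.
move=> /mx_irrP[_ irr1] /mx_irrP[_ irr2] N0 hN.
have fN : row_free N.
  rewrite -kermx_eq0; apply: contraNT N0 => kN0.
  have kfull : row_full (kermx N).
    apply: irr1 kN0; apply/mxmoduleP => x xG; apply/sub_kermxP.
    by rewrite -mulmxA hN // mulmxA mulmx_ker mul0mx.
  by apply/eqP/(row_full_inj kfull); rewrite mulmx_ker mulmx0.
have fullN : row_full N.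
  rewrite -[N]/(N) /row_full -(genmxE N); apply: irr2.
    rewrite (eqmx_module _ (genmxE N)).
    by apply/mxmoduleP => x xG; rewrite -hN // submxMl.
  by rewrite -mxrank_eq0 genmxE mxrank_eq0.
by exists N => //; rewrite -(eqP fN) (eqP fullN).
Qed.

Lemma affords_intro d d' (rG : mx_representation F G d) (rho' : mx_representation F G d')
    (U : 'M_d) (psi : 'M_(d, d')) : mxsimple rG U -> mx_irreducible rho' ->
  (forall x, x \in G -> rG x *m psi = psi *m rho' x) -> U *m psi != 0 ->
  affords rG U rho'.
Proof.
move=> simU irr' hpsi Upsi; have modU := mxsimple_module simU; exists modU.
have [V V0 VJ] : exists2 V : 'M_(\rank U, _), V *m psi != 0 &
    forall x, x \in G -> submod_mx modU x *m V = V *m rG x.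
  exists (val_submod 1%:M) => [|x xG].
    by rewrite -mxrank_eq0 (eqmxMr _ (val_submod1 _)) mxrank_eq0.
  by rewrite -(val_submodJ modU) // mul1mx [RHS]val_submodE.
apply: irr_hom_rsim V0 _ => //; first exact/submod_mx_irr.
by move=> x xG; rewrite (mulmxA _ V) VJ // -(mulmxA V) hpsi // (mulmxA V).
Qed.

(** The isomorphism between [U1] and [U2] is precomposed with a Maschke projection onto [U1], giving
    a map on the whole space, to which [twisted_part] applies. *)
Lemma affords_hom d1 d2 d' (r1 : mx_representation F G d1) (r2 : mx_representation F G d2)
    (rho' : mx_representation F G d') (U1 : 'M_d1) (U2 : 'M_d2) : U1 != 0 ->
  affords r1 U1 rho' -> affords r2 U2 rho' ->
  exists phi : 'M_(d1, d2),
    [/\ forall x, x \in G -> r1 x *m phi = phi *m r2 x, (phi <= U2)%MS & U1 *m phi != 0].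
Proof.
move=> U10 [mod1 rs1] [mod2 rs2].
have [B _ fB hB] := mx_rsim_trans rs1 (mx_rsim_sym rs2).
have [P hP [PU UP]] := module_projection mod1.
exists (val_submod (in_submod U1 P *m B)); split.
- move=> x xG; rewrite -(val_submodJ mod2) //.
  have IJ : in_submod U1 P *m submod_mx mod1 x = r1 x *m in_submod U1 P.
    by rewrite -(in_submodJ mod1) // -hP // in_submodE [in RHS]in_submodE (mulmxA (r1 x)).
  have -> : in_submod U1 P *m B *m submod_mx mod2 x = r1 x *m in_submod U1 P *m B.
    rewrite -IJ -(mulmxA _ B) -(mulmxA _ _ B); congr (_ *m _).
    exact/esym/hB.
  rewrite -(mulmxA (r1 x)) val_submodE [in RHS]val_submodE; exact: mulmxA.
- exact: val_submodP.
rewrite val_submodE (mulmxA U1) -val_submodE val_submod_eq0 mulmxA.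
rewrite (mulmx_free_eq0 _ fB) in_submodE mulmxA UP -in_submodE.
by rewrite -(val_submod_eq0 (U := U1)) in_submodK.
Qed.

End Homomorphisms.

Theorem theorem4p10 (F : numClosedFieldType) (r p n : nat)
    (hr : (0 < r)%N) (hp : (0 < p)%N) (hn : (0 < n)%N) (hpr : (p %| r)%N)
    (z : F) (prz : r.-primitive_root z)
    (d : multidiag r n -> nat)
    (rho : forall la : multidiag r n,
       mx_representation F [set: Gr1n prz n] (d la))
    (v : forall la : multidiag r n, tableau r n -> 'rV[F]_(d la))
    (hGT : forall la : multidiag r n, la \in calY r n ->
       GT_basis (rho la) la (v la))
    (hnorm : forall la : multidiag r n, la \in calY r n ->
       normalized (rho la) la (v la) p) :
  [/\ (* (a) *)
      forall la : multidiag r n, la \in calY r n ->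
        [/\ forall a : F,
              eigenvalue (associator la (v la) p) a <->
              exists l : 'I_(unum p la),
                a = z ^+ (l * (r %/ p * bnum p la)),
            forall l : 'I_(unum p la),
              (Vdelta z la (v la) p l :=:
               eigenspace (associator la (v la) p)
                 (z ^+ (l * (r %/ p * bnum p la))))%MS,
            (\sum_(l < unum p la) Vdelta z la (v la) p l :=: 1%:M)%MS &
            mxdirect (\sum_(l < unum p la) Vdelta z la (v la) p l)],
      (* (b) *)
      forall (la : multidiag r n) (l : 'I_(unum p la)), la \in calY r n ->
        mxsimple (res_Grpn (rho la) p) (Vdelta z la (v la) p l) &
      (* (c) *)
      forall R : {set multidiag r n},
        is_transversal R (calYmp r n p) (calY r n) ->
        (forall (d' : nat) (rho' : mx_representation F (Grpn prz n p) d'),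
           mx_irreducible rho' ->
           exists2 la : multidiag r n, la \in R &
             exists l : 'I_(unum p la),
               affords (res_Grpn (rho la) p) (Vdelta z la (v la) p l) rho')
        /\
        (forall (la mu : multidiag r n)
                (l : 'I_(unum p la)) (l' : 'I_(unum p mu)),
           la \in R -> mu \in R ->
           forall (d' : nat) (rho' : mx_representation F (Grpn prz n p) d'),
             affords (res_Grpn (rho la) p) (Vdelta z la (v la) p l) rho' ->
             affords (res_Grpn (rho mu) p) (Vdelta z mu (v mu) p l') rho' ->
             la = mu /\ l = l' :> nat)].
Proof.
have simple la (l : 'I_(unum p la)) : la \in calY r n ->
    mxsimple (res_Grpn (rho la) p) (Vdelta z la (v la) p l).
  by move=> laY; apply: Vdelta_simple => //; [apply: hGT | apply: hnorm].
split=> [la laY|la l laY|R tR].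
- have GT := hGT la laY; have [VE dV] := Vdelta_eigenspaces hpr hn GT.
  split=> // [a|]; first exact: (associator_eigenvalue hpr hn GT a).
  by apply/eqmxP; rewrite submx1 sub1mx (sum_Vdelta_full hpr hn GT).
- exact: simple.
have /subsetP RY := transversal_sub tR.
split=> [d' rho' irr'|la mu l l' laR muR d' rho' aff1 aff2].
  have [la laY [psi psi0 hpsi]] := Grpn_irr_hom hGT irr'.
  have [mu muR /(necklace_eqP hr hp hpr)[t muE]] := transversal_ex tR laY.
  have muY := RY _ muR.
  (* The twist by a power of [delta0 ^+ m] is trivial on [H], so [psi] can be transported to the
     chosen representative [mu]. *)
  have [C eqd fC hC] : mx_rsim (rho mu) (twist rho (t * (r %/ p)) la).
    by rewrite muE; apply: (twist_rsim hGT).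
  have Cpsi0 : C *m psi != 0.
    apply: contraNneq psi0 => Cpsi.
    have C_full : row_full C by rewrite /row_full (eqP fC) eqd.
    by apply/eqP/(row_full_inj C_full); rewrite Cpsi mulmx0.
  have hCpsi h : h \in Grpn prz n p -> rho mu h *m (C *m psi) = C *m psi *m rho' h.
    move=> hH; rewrite mulmxA hC ?inE // -!mulmxA -hpsi //=.
    move: hH; rewrite Grpn_delta0 mulnC exprM => /eqP->.
    by rewrite expr1n scale1r.
  exists mu => //.
  have /existsP[l Vl] : [exists l : 'I_(unum p mu),
      Vdelta z mu (v mu) p l *m (C *m psi) != 0].
    apply: contraNT Cpsi0 => /existsPn V0.
    apply/eqP/(row_full_inj (sum_Vdelta_full hpr hn (hGT mu muY))); rewrite mulmx0.
    apply/sub_kermxP/sumsmx_subP => l _; apply/sub_kermxP/eqP.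
    by have := V0 l; rewrite negbK.
  exists l; apply: affords_intro Vl => //; exact: simple.
have laY := RY _ laR; have muY := RY _ muR.
have V0 := Vdelta_neq0 hpr hn (hGT la laY) l.
have [phi [hphi phiV Vphi]] := affords_hom V0 aff1 aff2.
have phi0 : phi != 0 by apply: contraNneq Vphi => ->; rewrite mulmx0.
(* The twisted parts sum to [p%:R *: phi], so one is nonzero, and it forces [la] and [mu] into one
   necklace. *)
have [i phi_i] : exists i : 'I_p, twisted_part p hn (rho la) (rho mu) phi i != 0.
  apply/existsP; apply: contraNT phi0 => /existsPn all0.
  have p0 : p%:R != 0 :> F by rewrite pnatr_eq0 -lt0n.
  rewrite -[phi](scalerK p0).
  rewrite -(sum_twisted_part hp hpr hn (rho la) (rho mu)) big1 ?scaler0 // => i _.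
  by apply/eqP; have := all0 i; rewrite negbK.
have laE := twisted_hom_shape laY muY (hGT _ laY) (hGT _ muY)
  (twisted_partP hpr hn hphi i) phi_i.
have lamu : la = mu.
  apply/esym/(transversal_eq hr hp hpr tR) => //; apply/(necklace_eqP hr hp hpr).
  by exists i; rewrite mulnC.
subst mu; split=> //.
(* Now [phi] acts on the eigenspace of index [l] by a nonzero scalar yet lands in that of index
   [l'], so the two eigenvalues agree. *)
have [x xP] := Grpn_endo_scalar hp hpr hn laY (hGT _ laY) (hnorm _ laY)
  (z ^+ (l * (r %/ p * bnum p la))) hphi.
have VA := Vdelta_eigen hpr hn (hGT _ laY).
have xV := xP _ _ (VA l).
have x0 : x != 0 by apply: contraNneq Vphi => x0; rewrite xV x0 scale0r.
have VV : (Vdelta z la (v la) p l <= Vdelta z la (v la) p l')%MS.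
  by rewrite -(eqmx_scale _ x0) -xV mulmx_sub.
apply: (zmb_inj prz hpr) => //.
have : Vdelta z la (v la) p l *m associator la (v la) p =
    z ^+ (l' * (r %/ p * bnum p la)) *: Vdelta z la (v la) p l.
  by apply/eigenspaceP; rewrite -(Vdelta_eigenspaces hpr hn (hGT _ laY)).1.
rewrite VA => /eqP; rewrite -subr_eq0 -scalerBl scaler_eq0 (negPf V0) orbF subr_eq0.
by move/eqP.
Qed.
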